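(* Let $q$ be a prime power, let $\delta$ be a generator of $\mathbb F_{q^2}^\times$, and let $M\subseteq\mathbb Z/(q^2-1)\mathbb Z$ be a union of cosets of the subgroup $(q-1)\mathbb Z/(q^2-1)\mathbb Z$. Let $$S=\{0,\infty\}\cup\{\delta^{-i(q+1)}: i\in M\}\subseteq\mathbb P^1(\mathbb F_q).$$ Then the assignment $a_i\mapsto[1+\delta^iF]$ ($i\in M$) defines an isomorphism of groups $$\Gamma_{M,\delta}\xrightarrow{\ \sim\ }\Gamma_S .$$
   Context: Finite-field data: for $i,j\in\mathbb Z/(q^2-1)\mathbb Z$ with $i\not\equiv j\pmod{q-1}$ one has $1+\delta^{j-i}\neq0$; let $x_{i,j}\in\mathbb Z/(q^2-1)\mathbb Z$ be the unique element with $\delta^{x_{i,j}}=1+\delta^{j-i}$, put $y_{i,j}=x_{i,j}+i-j$ (so $\delta^{y_{i,j}}=1+\delta^{i-j}$), and $$l(i,j)=i-x_{i,j}(q-1),\qquad k(i,j)=j-y_{i,j}(q-1).$$ The group $\Gamma_{M,\delta}$ is defined by the presentation with generators $a_i$ ($i\in M$) and relations: $a_ia_j=a_{k(i,j)}a_{l(i,j)}$ for all $i,j\in M$ with $i\not\equiv j\pmod{q-1}$, together with $a_{i+(q^2-1)/2}\,a_i=1$ for all $i\in M$ if $q$ is odd, respectively $a_i^2=1$ for all $i\in M$ if $q$ is even. Quaternions: let $K=\mathbb F_q(t)$. If $q$ is odd, fix a non-square $c\in\mathbb F_q$ and let $D=K\{Z,F\}/(Z^2=c,\ F^2=t,\ FZ=-ZF)$.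 If $q$ is even, fix $c\in\mathbb F_q$ with $X^2+X+c$ irreducible over $\mathbb F_q$ and let $D=K\{Z,F\}/(Z^2+Z=c,\ F^2=t,\ FZ=(Z+1)F)$. The subring $\mathbb F_q[Z]=\mathbb F_q\oplus\mathbb F_qZ\subseteq D$ is a field with $q^2$ elements, identified with $\mathbb F_{q^2}$; $N(\alpha)=\alpha^{q+1}$ is its norm to $\mathbb F_q$, and $F\alpha=\alpha^qF$. Let $B=\{0,\infty\}$. For a finite set $S\supseteq B$ of places of $K$, $S_0=S\setminus B$, let $\mathfrak o_{K,S}$ be the ring of $S$-integers, $\mathcal A(\mathfrak o_{K,S})=\mathfrak o_{K,S}\oplus\mathfrak o_{K,S}Z\oplus\mathfrak o_{K,S}F\oplus\mathfrak o_{K,S}FZ$, $\Lambda_S=\mathcal A(\mathfrak o_{K,S})^\times/\mathfrak o_{K,S}^\times$, and write $[w]$ for the class of $w$. For $\tau\in\mathbb F_q^\times$ put $PA_\tau=\{[1+\alpha F]:\alpha\in\mathbb F_q[Z],\ N(\alpha)=\tau^{-1}\}$. For $S$ a set of $\mathbb F_q$-rational places, $\Gamma_S\subseteq\Lambda_S$ is the subgroup generated by all $PA_\tau$, $\tau\in S_0$. *)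

(* Defs.v *)
From HB Require Import structures.
From mathcomp Require Import all_boot all_order all_fingroup all_algebra.
From mathcomp Require Import all_solvable.
From mathcomp Require Import generic_quotient boolp ring.

Set Implicit Arguments.
Unset Strict Implicit.
Unset Printing Implicit Defensive.

Import GRing.Theory.
Local Open Scope ring_scope.

Section Presentation.
Local Open Scope quotient_scope.
Variable I : choiceType.

(* (true, i) stands for the generator i and (false, i) for its inverse. *)
Definition word := seq (bool * I).

Variable rel : word -> word -> Prop.

Inductive pres_eq : word -> word -> Prop :=
| pres_refl u : pres_eq u u
| pres_sym u v : pres_eq u v -> pres_eq v u
| pres_trans u v w : pres_eq u v -> pres_eq v w -> pres_eq u w
| pres_cat u1 v1 u2 v2 :
    pres_eq u1 v1 -> pres_eq u2 v2 -> pres_eq (u1 ++ u2) (v1 ++ v2)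
| pres_cancel b i : pres_eq [:: (b, i); (~~ b, i)] [::]
| pres_rel u v : rel u v -> pres_eq u v.

Definition pres_eqb (u v : word) : bool := `[< pres_eq u v >].

Lemma pres_eqb_equiv : equiv_class_of pres_eqb.
Proof.
split=> [u|u v|v u w]; first exact/asboolP/pres_refl.
- by apply/asboolP/asboolP; apply: pres_sym.
- by move=> /asboolP uv /asboolP vw; apply/asboolP/(pres_trans uv).
Qed.

Canonical pres_equiv := EquivRelPack pres_eqb_equiv.

Definition pres_group := {eq_quot pres_equiv}.

HB.instance Definition _ := Choice.on pres_group.
HB.instance Definition _ := Quotient.on pres_group.
HB.instance Definition _ := EqQuotient.on pres_group.

Definition word_inv (u : word) : word := rev [seq (~~ x.1, x.2) | x <- u].

Definition pres_one : pres_group := \pi_pres_group [::].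
Definition pres_mul (x y : pres_group) : pres_group :=
  \pi_pres_group (repr x ++ repr y).
Definition pres_inv (x : pres_group) : pres_group :=
  \pi_pres_group (word_inv (repr x)).

Lemma pres_piP u v : \pi_pres_group u = \pi_pres_group v <-> pres_eq u v.
Proof.
by split=> [/eqmodP/asboolP //|uv]; apply/eqmodP/asboolP.
Qed.

Lemma pres_repr u : pres_eq (repr (\pi_pres_group u)) u.
Proof. by apply/pres_piP; rewrite reprK. Qed.

Lemma pres_piM u v :
  pres_mul (\pi_pres_group u) (\pi_pres_group v) = \pi_pres_group (u ++ v).
Proof. by apply/pres_piP/pres_cat; apply: pres_repr. Qed.

Lemma word_inv_cat u v : word_inv (u ++ v) = word_inv v ++ word_inv u.
Proof. by rewrite /word_inv map_cat rev_cat. Qed.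

Lemma word_invK : involutive word_inv.
Proof.
move=> u; rewrite /word_inv map_rev revK -map_comp -[RHS]map_id.
by apply: eq_map => -[b i] /=; rewrite negbK.
Qed.

Lemma word_mulV u : pres_eq (u ++ word_inv u) [::].
Proof.
elim: u => [|[b i] u IHu]; first exact: pres_refl.
rewrite -cat1s word_inv_cat -catA (catA u).
apply: pres_trans (pres_cancel b i); apply: (@pres_cat [:: _] [:: _]).
  exact: pres_refl.
by apply: (@pres_cat _ [::] _ [:: _]) => //; apply: pres_refl.
Qed.

Lemma word_mulVl u : pres_eq (word_inv u ++ u) [::].
Proof. by rewrite -{2}[u]word_invK; apply: word_mulV. Qed.

Lemma pres_mulA : associative pres_mul.
Proof.
elim/quotW=> u; elim/quotW=> v; elim/quotW=> w.
by rewrite (pres_piM v w) (pres_piM u v) (pres_piM u) (pres_piM _ w) catA.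
Qed.

Lemma pres_mul1 : left_id pres_one pres_mul.
Proof. by elim/quotW=> u; rewrite pres_piM. Qed.

Lemma pres_mulr1 : right_id pres_one pres_mul.
Proof. by elim/quotW=> u; rewrite pres_piM cats0. Qed.

Lemma pres_mulV : left_inverse pres_one pres_inv pres_mul.
Proof.
elim/quotW=> u; rewrite -[X in pres_mul _ X]reprK pres_piM.
exact/pres_piP/word_mulVl.
Qed.

Lemma pres_mulrV : right_inverse pres_one pres_inv pres_mul.
Proof.
elim/quotW=> u; rewrite -[X in pres_mul X _]reprK pres_piM.
exact/pres_piP/word_mulV.
Qed.

HB.instance Definition _ := isGroup.Build pres_group
  pres_mulA pres_mul1 pres_mulr1 pres_mulV pres_mulrV.

Definition pres_gen (i : I) : pres_group := \pi_pres_group [:: (true, i)].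

End Presentation.

Section Generated.
Local Open Scope group_scope.
Variables (G : groupType) (X : G -> Prop).

Definition generated : pred G := fun g =>
  `[< forall H : {pred G}, group_closed H ->
        (forall x, X x -> x \in H) -> g \in H >].

Lemma generated_closed : group_closed generated.
Proof.
split=> [|x y /asboolP xG /asboolP yG]; apply/asboolP => H Hgrp XH.
  by case: Hgrp.
by case: (Hgrp) => _; apply; [apply: xG | apply: yG].
Qed.

Definition generated_group := {x : G | generated x}.

HB.instance Definition _ := SubChoice.on generated_group.
HB.instance Definition _ :=
  SubChoice_isSubGroup.Build G generated generated_group generated_closed.

End Generated.

(* The R-algebra with basis 1, Z, F, FZ and relations
   Z^2 = s Z + c, F^2 = t, F Z = (s - Z) F. *)
Record quat (R : comNzRingType) (s c t : R) :=
  Quat { q1 : R; qZ : R; qF : R; qFZ : R }.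
Arguments Quat {R s c t}.

Section Quat.
Variables (R : comNzRingType) (s c t : R).
Local Notation A := (quat s c t).

Definition quat_encode (x : A) := (q1 x, qZ x, qF x, qFZ x).
Definition quat_decode (x : R * R * R * R) : A :=
  Quat x.1.1.1 x.1.1.2 x.1.2 x.2.
Lemma quat_encodeK : cancel quat_encode quat_decode. Proof. by case. Qed.
HB.instance Definition _ := Choice.copy A (can_type quat_encodeK).

Definition quat_add (x y : A) : A :=
  Quat (q1 x + q1 y) (qZ x + qZ y) (qF x + qF y) (qFZ x + qFZ y).
Definition quat_opp (x : A) : A := Quat (- q1 x) (- qZ x) (- qF x) (- qFZ x).
Definition quat_scale (a : R) (x : A) : A :=
  Quat (a * q1 x) (a * qZ x) (a * qF x) (a * qFZ x).

(* With x = u + F v and y = u' + F v', where u, v, u', v' lie in R[Z], and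
   with conj the R-automorphism Z |-> s - Z of R[Z],
   x y = (u u' + t conj(v) v') + F (conj(u) v' + v u'). *)
Definition quat_mul (x y : A) : A :=
  Quat (q1 x * q1 y + c * (qZ x * qZ y)
        + t * ((qF x + s * qFZ x) * qF y - c * (qFZ x * qFZ y)))
       (q1 x * qZ y + qZ x * q1 y + s * (qZ x * qZ y)
        + t * (qF x * qFZ y - qFZ x * qF y))
       ((q1 x + s * qZ x) * qF y - c * (qZ x * qFZ y)
        + (qF x * q1 y + c * (qFZ x * qZ y)))
       (q1 x * qFZ y - qZ x * qF y
        + (qF x * qZ y + qFZ x * q1 y + s * (qFZ x * qZ y))).

Lemma quat_addA : associative quat_add.
Proof. by move=> [????] [????] [????]; rewrite /quat_add /= !addrA. Qed.
Lemma quat_addC : commutative quat_add.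
Proof. by move=> [????] [????]; congr Quat; exact: addrC. Qed.
Lemma quat_add0 : left_id (Quat 0 0 0 0) quat_add.
Proof. by move=> [????]; rewrite /quat_add /= !add0r. Qed.
Lemma quat_addN : left_inverse (Quat 0 0 0 0) quat_opp quat_add.
Proof. by move=> [????]; rewrite /quat_add /= !addNr. Qed.

HB.instance Definition _ :=
  GRing.isZmodule.Build A quat_addA quat_addC quat_add0 quat_addN.

Lemma quat_mulA : associative quat_mul.
Proof.
by move=> [????] [????] [????]; rewrite /quat_mul /=; congr Quat; ring.
Qed.
Lemma quat_mul1 : left_id (Quat 1 0 0 0) quat_mul.
Proof. by move=> [????]; rewrite /quat_mul /=; congr Quat; ring. Qed.
Lemma quat_mulr1 : right_id (Quat 1 0 0 0) quat_mul.
Proof. by move=> [????]; rewrite /quat_mul /=; congr Quat; ring. Qed.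
Lemma quat_mulDl : left_distributive quat_mul quat_add.
Proof.
by move=> [????] [????] [????]; rewrite /quat_mul /quat_add /=; congr Quat; ring.
Qed.
Lemma quat_mulDr : right_distributive quat_mul quat_add.
Proof.
by move=> [????] [????] [????]; rewrite /quat_mul /quat_add /=; congr Quat; ring.
Qed.
Lemma quat_1neq0 : Quat 1 0 0 0 != 0 :> A.
Proof. by apply/eqP => -[/eqP]; rewrite oner_eq0. Qed.

HB.instance Definition _ := GRing.Zmodule_isNzRing.Build A
  quat_mulA quat_mul1 quat_mulr1 quat_mulDl quat_mulDr quat_1neq0.

Lemma quat_scaleA a b x :
  quat_scale a (quat_scale b x) = quat_scale (a * b) x.
Proof. by case: x => *; rewrite /quat_scale /= !mulrA. Qed.
Lemma quat_scale1 : left_id 1 quat_scale.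
Proof. by move=> [????]; rewrite /quat_scale /= !mul1r. Qed.
Lemma quat_scaleDr : right_distributive quat_scale +%R.
Proof. by move=> a [????] [????]; congr Quat; exact: mulrDr. Qed.
Lemma quat_scaleDl x : {morph quat_scale^~ x : a b / a + b}.
Proof. by move=> a b; congr Quat; exact: mulrDl. Qed.

HB.instance Definition _ := GRing.Zmodule_isLmodule.Build R A
  quat_scaleA quat_scale1 quat_scaleDr quat_scaleDl.

Lemma quat_scaleAl (a : R) (x y : A) : a *: (x * y) = a *: x * y.
Proof.
by case: x y => [????] [????]; congr Quat => /=; ring.
Qed.
HB.instance Definition _ := GRing.Lmodule_isLalgebra.Build R A quat_scaleAl.

Lemma quat_scaleAr (a : R) (x y : A) : a *: (x * y) = x * (a *: y).
Proof.
by case: x y => [????] [????]; congr Quat => /=; ring.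
Qed.
HB.instance Definition _ := GRing.Lalgebra_isAlgebra.Build R A quat_scaleAr.

Definition quatZ : A := Quat 0 1 0 0.
Definition quatF : A := Quat 0 0 1 0.

Lemma quatE (x : A) :
  x = q1 x *: 1 + qZ x *: quatZ + qF x *: quatF + qFZ x *: (quatF * quatZ).
Proof. by case: x => [????]; congr Quat => /=; ring. Qed.
Lemma quat_ZZ : quatZ * quatZ = s *: quatZ + c%:A.
Proof. by congr Quat => /=; ring. Qed.
Lemma quat_FF : quatF * quatF = t%:A.
Proof. by congr Quat => /=; ring. Qed.
Lemma quat_FZ : quatF * quatZ = (s%:A - quatZ) * quatF.
Proof. by congr Quat => /=; ring. Qed.

End Quat.
Arguments quatZ {R s c t}.
Arguments quatF {R s c t}.

Section Setting.
Variable Fq : finFieldType.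

Local Notation q := #|Fq|.
Local Notation K := {fraction {poly Fq}}.
Local Notation "p %:F" := (tofrac p).

Definition FqK (a : Fq) : K := a%:P%:F.

Definition admissible_const (c : Fq) : Prop :=
  if odd q then forall x : Fq, x ^+ 2 != c
  else irreducible_poly ('X^2 + 'X + c%:P).

(* s = 0 gives Z^2 = c, FZ = -ZF for q odd, and s = 1 gives Z^2 + Z = c,
   FZ = (Z + 1)F for q even, as -1 = 1 then: see D_odd and D_even. *)
Definition trZ : K := if odd q then 0 else 1.
Definition D (c : Fq) := quat trZ (FqK c) ('X%:F).

HB.instance Definition _ c := GRing.Algebra.on (D c).

Definition DZ c : D c := quatZ.
Definition DF c : D c := quatF.

Lemma D_FF c : DF c ^+ 2 = ('X%:F)%:A.
Proof. exact: quat_FF. Qed.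

Lemma D_odd c : odd q ->
  DZ c ^+ 2 = (FqK c)%:A /\ DF c * DZ c = - (DZ c * DF c).
Proof.
move=> qodd; have sD (x : D c) : trZ *: x = 0.
  by rewrite -(scale0r x); congr (_ *: _); rewrite /trZ qodd.
by rewrite expr2 /DZ /DF quat_ZZ quat_FZ !sD add0r sub0r mulNr.
Qed.

Lemma Fq_even : ~~ odd q -> 1 + 1 = 0 :> Fq.
Proof.
rewrite -dvdn2 -cardsT => /(Cauchy (isT : prime 2))[x _ ox].
have xx : x + x = 0 :> Fq by have := expg_order x; rewrite ox.
have xn0 : x != 0.
  by apply/eqP => x0; move: ox; rewrite x0 (order1 Fq).
by apply: (mulIf xn0); rewrite mulrDl mul1r mul0r.
Qed.

Lemma D_even c : ~~ odd q ->
  DZ c ^+ 2 + DZ c = (FqK c)%:A /\ DF c * DZ c = (DZ c + 1) * DF c.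
Proof.
move=> qeven; have K2 : 1 + 1 = 0 :> K.
  by rewrite -tofrac1 -tofracD -polyC1 -polyCD Fq_even // polyC0 tofrac0.
have D2 (x : D c) : x + x = 0.
  by rewrite -(scale1r x) -scalerDl K2 scale0r.
have DN (x : D c) : - x = x by apply/eqP; rewrite eq_sym -addr_eq0 D2.
have sD (x : D c) : trZ *: x = x.
  by rewrite -[RHS]scale1r; congr (_ *: _); rewrite /trZ (negPf qeven).
rewrite expr2 /DZ /DF quat_ZZ quat_FZ !sD (DN quatZ) addrAC (D2 quatZ) add0r.
by rewrite addrC.
Qed.

Definition inFqZ c (x : D c) : Prop :=
  exists a b : Fq, x = (FqK a)%:A + FqK b *: DZ c.

Definition FqZ_generator c (delta : D c) : Prop :=
  [/\ inFqZ delta, delta != 0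
    & forall x : D c, inFqZ x -> x != 0 -> exists n : nat, x = delta ^+ n].

Definition FqZ_norm c (x : D c) : D c := x ^+ q.+1.

(* P^1(F_q): Some a is the point a of F_q, and None is infinity. *)
Definition P1 := option Fq.
Definition P1B : {set P1} := [set Some 0; None].

Definition integral_at (pi : {poly Fq}) (x : K) : Prop :=
  exists a b : {poly Fq}, x = a%:F / b%:F /\ ~~ (pi %| b).
Definition integral_at_infty (x : K) : Prop :=
  exists a b : {poly Fq}, [/\ b != 0, x = a%:F / b%:F & (size a <= size b)%N].

(* The finite places of K are the monic irreducible polynomials; the rational
   point a is the place 'X - a. *)
Definition S_integer (S : {set P1}) (x : K) : Prop :=
  (None \notin S -> integral_at_infty x) /\
  (forall pi : {poly Fq}, pi \is monic -> irreducible_poly pi ->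
     (forall a : Fq, Some a \in S -> pi != 'X - a%:P) -> integral_at pi x).

Definition S_order (S : {set P1}) c (x : D c) : Prop :=
  [/\ S_integer S (q1 x), S_integer S (qZ x),
      S_integer S (qF x) & S_integer S (qFZ x)].

Definition S_integer_unit (S : {set P1}) (a : K) : Prop :=
  S_integer S a /\ exists b, S_integer S b /\ a * b = 1.

Definition S_order_unit (S : {set P1}) c (x : D c) : Prop :=
  S_order S x /\ exists y, [/\ S_order S y, x * y = 1 & y * x = 1].

(* Only sets of places containing B are considered, as otherwise S_order
   need not be a ring. *)
Record placeSet := PlaceSet { places :> {set P1}; places_B : P1B \subset places }.

Section Lambda.
Variables (S : placeSet) (c : Fq).
Local Open Scope quotient_scope.

Lemma integral_add pi x y : irreducible_poly pi ->
  integral_at pi x -> integral_at pi y -> integral_at pi (x + y).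
Proof.
move=> ipi [a [b [-> pib]]] [a' [b' [-> pib']]].
have b0 d : ~~ (pi %| d) -> d%:F != 0 :> K.
  by apply: contraNneq => /eqP; rewrite tofrac_eq0 => /eqP ->; rewrite dvdp0.
exists (a * b' + a' * b), (b * b'); split.
  by rewrite addf_div ?b0 // tofracD !tofracM.
by rewrite -irreducible_poly_coprime // coprimepMr !irreducible_poly_coprime //
  pib.
Qed.

Lemma integral_mul pi x y : irreducible_poly pi ->
  integral_at pi x -> integral_at pi y -> integral_at pi (x * y).
Proof.
move=> ipi [a [b [-> pib]]] [a' [b' [-> pib']]].
exists (a * a'), (b * b'); split; first by rewrite mulf_div !tofracM.
by rewrite -irreducible_poly_coprime // coprimepMr !irreducible_poly_coprime //
  pib.
Qed.

Lemma S_integerP x : S_integer S x <->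
  forall pi : {poly Fq}, pi \is monic -> irreducible_poly pi ->
     (forall a : Fq, Some a \in places S -> pi != 'X - a%:P) ->
  integral_at pi x.
Proof.
split=> [[] //|xint]; split=> //.
by rewrite (subsetP (places_B S)) // !inE eqxx orbT.
Qed.

Lemma S_integerD x y : S_integer S x -> S_integer S y -> S_integer S (x + y).
Proof.
move=> /S_integerP xS /S_integerP yS; apply/S_integerP=> pi pim pii piS.
by apply: integral_add => //; [apply: xS | apply: yS].
Qed.

Lemma S_integerM x y : S_integer S x -> S_integer S y -> S_integer S (x * y).
Proof.
move=> /S_integerP xS /S_integerP yS; apply/S_integerP=> pi pim pii piS.
by apply: integral_mul => //; [apply: xS | apply: yS].
Qed.

Lemma S_integer_tofrac (p : {poly Fq}) : S_integer S p%:F.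
Proof.
apply/S_integerP => pi _ [pi1 _] _; exists p, 1; rewrite tofrac1 divr1.
by split=> //; rewrite dvdp1 neq_ltn pi1 orbT.
Qed.

Lemma S_integer0 : S_integer S 0.
Proof. by rewrite -tofrac0; apply: S_integer_tofrac. Qed.
Lemma S_integer1 : S_integer S 1.
Proof. by rewrite -tofrac1; apply: S_integer_tofrac. Qed.

Lemma S_integerN x : S_integer S x -> S_integer S (- x).
Proof.
move=> xS; rewrite -mulN1r; apply: S_integerM => //.
by rewrite -tofrac1 -tofracN; apply: S_integer_tofrac.
Qed.

Lemma S_integer_trZ : S_integer S trZ.
Proof.
by rewrite /trZ; case: ifP => _; [apply: S_integer0 | apply: S_integer1].
Qed.

Lemma S_order1 : S_order S (1 : D c).
Proof.
by split; (apply: S_integer1 || apply: S_integer0).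
Qed.

Lemma S_orderM (x y : D c) : S_order S x -> S_order S y -> S_order S (x * y).
Proof.
case: x y => [x1 x2 x3 x4] [y1 y2 y3 y4] [/= ????] [/= ????].
by split=> /=; repeat (exact: S_integer_tofrac || exact: S_integer_trZ ||
  assumption || apply: S_integerD || apply: S_integerM || apply: S_integerN).
Qed.

Lemma S_orderZ a (x : D c) :
  S_integer S a -> S_order S x -> S_order S (a *: x).
Proof. by move=> aS [????]; split; apply: S_integerM. Qed.

Definition order_unit := {x : D c | `[< S_order_unit S x >]}.
HB.instance Definition _ := SubChoice.on order_unit.

Lemma order_unitP (u : order_unit) : S_order_unit S (val u).
Proof. exact/asboolP/(valP u). Qed.

Lemma S_order_unit1 : S_order_unit S (1 : D c).
Proof. by split; [|exists 1; rewrite mul1r; split=> //]; apply: S_order1. Qed.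

Lemma S_order_unitM (x y : D c) :
  S_order_unit S x -> S_order_unit S y -> S_order_unit S (x * y).
Proof.
move=> [xA [x' [x'A xx' x'x]]] [yA [y' [y'A yy' y'y]]].
split; first exact: S_orderM.
exists (y' * x'); split; first exact: S_orderM.
  by rewrite mulrA -(mulrA x) yy' mulr1.
by rewrite mulrA -(mulrA y') x'x mulr1.
Qed.

Lemma S_order_unitV (u : order_unit) :
  {v : order_unit | val u * val v = 1 & val v * val u = 1}.
Proof.
have [uA uV] := order_unitP u; have [v [vA uv vu]] := cid uV.
have vU : `[< S_order_unit S v >] by apply/asboolP; split=> //; exists (val u).
by exists (exist _ v vU).
Qed.

Definition order_unit1 : order_unit := exist _ 1 (asboolT S_order_unit1).
Definition order_unitM (u v : order_unit) : order_unit :=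
  exist _ (val u * val v)
    (asboolT (S_order_unitM (order_unitP u) (order_unitP v))).
Definition order_unitV (u : order_unit) : order_unit := s2val (S_order_unitV u).

Lemma order_unit_mulA : associative order_unitM.
Proof. by move=> u v w; apply: val_inj; rewrite /= mulrA. Qed.
Lemma order_unit_mul1 : left_id order_unit1 order_unitM.
Proof. by move=> u; apply: val_inj; rewrite /= mul1r. Qed.
Lemma order_unit_mulr1 : right_id order_unit1 order_unitM.
Proof. by move=> u; apply: val_inj; rewrite /= mulr1. Qed.
Lemma order_unit_mulV : left_inverse order_unit1 order_unitV order_unitM.
Proof. by move=> u; apply: val_inj; apply: (s2valP' (S_order_unitV u)). Qed.
Lemma order_unit_mulrV : right_inverse order_unit1 order_unitV order_unitM.
Proof. by move=> u; apply: val_inj; apply: (s2valP (S_order_unitV u)). Qed.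

HB.instance Definition _ := isGroup.Build order_unit order_unit_mulA
  order_unit_mul1 order_unit_mulr1 order_unit_mulV order_unit_mulrV.

Definition same_class (u v : order_unit) : Prop :=
  exists2 a : K, S_integer_unit S a & val v = a *: val u.

Definition same_classb (u v : order_unit) : bool := `[< same_class u v >].

Lemma S_integer_unit1 : S_integer_unit S 1.
Proof. by split; [|exists 1; rewrite mul1r; split=> //]; apply: S_integer1. Qed.

Lemma S_integer_unitM a b :
  S_integer_unit S a -> S_integer_unit S b -> S_integer_unit S (a * b).
Proof.
move=> [aS [a' [a'S aa']]] [bS [b' [b'S bb']]]; split; first exact: S_integerM.
by exists (a' * b'); rewrite mulrACA aa' bb' mulr1; split=> //; apply: S_integerM.
Qed.

Lemma same_classb_equiv : equiv_class_of same_classb.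
Proof.
split=> [u|u v|v u w].
- by apply/asboolP; exists 1; [apply: S_integer_unit1 | rewrite scale1r].
- suff sym u' v' : same_class u' v' -> same_class v' u'.
    by apply/asboolP/asboolP; apply: sym.
  move=> [a [aS [b [bS ab]]] v'E]; exists b.
    by split=> //; exists a; rewrite mulrC.
  by rewrite v'E scalerA mulrC ab scale1r.
- move=> /asboolP[a aU uE] /asboolP[b bU wE]; apply/asboolP.
  exists (b * a); first exact: S_integer_unitM.
  by rewrite wE uE scalerA.
Qed.

Canonical same_class_equiv := EquivRelPack same_classb_equiv.

Definition Lambda := {eq_quot same_class_equiv}.

HB.instance Definition _ := Choice.on Lambda.
HB.instance Definition _ := Quotient.on Lambda.
HB.instance Definition _ := EqQuotient.on Lambda.

Definition Lambda_pi (u : order_unit) : Lambda := \pi_Lambda u.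

Lemma Lambda_piP u v : Lambda_pi u = Lambda_pi v <-> same_class u v.
Proof. by split=> [/eqmodP/asboolP //|uv]; apply/eqmodP/asboolP. Qed.

Definition Lambda1 : Lambda := Lambda_pi 1%g.
Definition LambdaM (x y : Lambda) : Lambda := Lambda_pi (repr x * repr y)%g.
Definition LambdaV (x : Lambda) : Lambda := Lambda_pi (repr x)^-1%g.

Lemma Lambda_repr u : same_class (repr (Lambda_pi u)) u.
Proof. by apply/Lambda_piP; rewrite /Lambda_pi reprK. Qed.

Lemma Lambda_piM u v : LambdaM (Lambda_pi u) (Lambda_pi v) = Lambda_pi (u * v)%g.
Proof.
apply/Lambda_piP; have [a aU uE] := Lambda_repr u.
have [b bU vE] := Lambda_repr v; exists (a * b); first exact: S_integer_unitM.
by rewrite /= uE vE -scalerAl -scalerAr scalerA.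
Qed.

Lemma LambdaW (P : Lambda -> Prop) : (forall u, P (Lambda_pi u)) -> forall x, P x.
Proof. by move=> Ppi; elim/quotW. Qed.

Lemma Lambda_mulA : associative LambdaM.
Proof.
elim/LambdaW=> u; elim/LambdaW=> v; elim/LambdaW=> w.
by rewrite (Lambda_piM v w) (Lambda_piM u v) (Lambda_piM u) (Lambda_piM _ w)
  mulgA.
Qed.
Lemma Lambda_mul1 : left_id Lambda1 LambdaM.
Proof. by elim/LambdaW=> u; rewrite Lambda_piM mul1g. Qed.
Lemma Lambda_mulr1 : right_id Lambda1 LambdaM.
Proof. by elim/LambdaW=> u; rewrite Lambda_piM mulg1. Qed.
Lemma Lambda_mulV : left_inverse Lambda1 LambdaV LambdaM.
Proof.
move=> x; rewrite -[X in LambdaM _ X]reprK.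
by rewrite [LambdaM _ _]Lambda_piM mulVg.
Qed.
Lemma Lambda_mulrV : right_inverse Lambda1 LambdaV LambdaM.
Proof.
move=> x; rewrite -[X in LambdaM X _]reprK.
by rewrite [LambdaM _ _]Lambda_piM mulgV.
Qed.

HB.instance Definition _ := isGroup.Build Lambda
  Lambda_mulA Lambda_mul1 Lambda_mulr1 Lambda_mulV Lambda_mulrV.

(* g = [w]; in particular w is a unit of the order. *)
Definition is_class (w : D c) (g : Lambda) : Prop :=
  exists2 u : order_unit, val u = w & g = Lambda_pi u.

Definition PA (tau : Fq) (g : Lambda) : Prop :=
  exists alpha : D c, [/\ inFqZ alpha, FqZ_norm alpha = (FqK tau^-1)%:A
    & is_class (1 + alpha * DF c) g].

Definition GammaS := generated_group (fun g : Lambda =>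
  exists2 tau : Fq, Some tau \in places S :\: P1B & PA tau g).

HB.instance Definition _ := Group.on GammaS.

End Lambda.

Section GammaM.
(* q >= 2, so the modulus is at least 3 and 'Z_(q ^ 2 - 1) is Z/(q^2 - 1). *)
Local Notation ZN := 'Z_(q ^ 2 - 1).
Variables (c : Fq) (delta : D c) (M : {set ZN}).

Definition is_coset (C : {set ZN}) : Prop :=
  exists i : ZN, C = [set i + m *+ q.-1 | m : ZN].

Definition union_of_cosets : Prop :=
  exists2 P : {set {set ZN}}, (forall C, C \in P -> is_coset C) & M = cover P.

(* The default value 0 is irrelevant: x_exp is only used for i <> j mod q - 1,
   where the exponent exists and is unique. *)
Definition x_exp (i j : ZN) : ZN :=
  odflt 0 [pick x : ZN | delta ^+ x == 1 + delta ^+ (j - i)%R].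
Definition y_exp (i j : ZN) : ZN := x_exp i j + i - j.
Definition l_exp (i j : ZN) : ZN := i - x_exp i j *+ q.-1.
Definition k_exp (i j : ZN) : ZN := j - y_exp i j *+ q.-1.

Definition GammaM_index := {i : ZN | i \in M}.
HB.instance Definition _ := Finite.on GammaM_index.

(* Indices are elements of M bundled with a proof of membership, so the values
   of k_exp and l_exp, and i + (q^2 - 1)/2, enter through elements k, l, h of
   the index type; they exist when M is a union of cosets. *)
Inductive GammaM_rel : word GammaM_index -> word GammaM_index -> Prop :=
| GammaM_rel_square (i j k l : GammaM_index) :
    val i != val j %[mod q.-1] ->
    val k = k_exp (val i) (val j) -> val l = l_exp (val i) (val j) ->
    GammaM_rel [:: (true, i); (true, j)] [:: (true, k); (true, l)]
| GammaM_rel_odd (i h : GammaM_index) :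
    odd q -> val h = val i + ((q ^ 2 - 1)./2)%:R ->
    GammaM_rel [:: (true, h); (true, i)] [::]
| GammaM_rel_even (i : GammaM_index) :
    ~~ odd q -> GammaM_rel [:: (true, i); (true, i)] [::].

Definition GammaM := pres_group GammaM_rel.
HB.instance Definition _ := Group.on GammaM.
Definition GammaM_gen (i : GammaM_index) : GammaM := pres_gen GammaM_rel i.

(* delta ^ (- i (q + 1)) lies in F_q; here Some tau is in the set iff tau is
   one of these elements. *)
Definition SM_rational : {set P1} :=
  [set Some tau | tau : Fq &
    [exists i in M, (FqK tau)%:A == delta ^+ (- (i *+ q.+1))%R]].

Definition SM : placeSet := PlaceSet (subsetUl P1B SM_rational).

End GammaM.

End Setting.

(* Main.v *)
From HB Require Import structures.
Require Import Defs.
From mathcomp Require Import all_boot all_order all_fingroup all_algebra.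
From mathcomp Require Import all_solvable all_field.
From mathcomp Require Import generic_quotient boolp ring zify.

(* The square relations preserve length and exchange letters of different
   types, the type of a_i being the norm of delta^i. So a positive word of
   minimal length representing a given nontrivial element of Gamma_{M,delta}
   can be written w1 w2, where w1 is a nonempty reduced word in letters of one
   type, attached to the place tau, and w2 contains no letter of that type.
   Modulo t - tau the letters of w1 become elements of rank one of a 2 x 2
   matrix algebra, and reducedness keeps their product nonzero, whereas the
   letters of w2 become units. The image of w1 w2 modulo t - tau is thus nonzero
   and not invertible, so w1 w2 is not a scalar and its class is nontrivial. *)

Set Implicit Arguments.
Unset Strict Implicit.
Unset Printing Implicit Defensive.

Import GRing.Theory.
Local Open Scope ring_scope.

Arguments Quat {R s c t}.
Arguments quatF {R s c t}.
Local Notation "p %:F" := (tofrac p).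

(** * The field F_q[Z] *)

Lemma card_finField_gt1 (Fq : finFieldType) : (1 < #|Fq|)%N.
Proof. exact: finNzRing_gt1. Qed.

(** The trace of [Z] over F_q: both parities then read [Z^2 = trFq Z + c], and conjugation is [Z] to
    [trFq - Z]. *)
Definition trFq (Fq : finFieldType) : Fq := if odd #|Fq| then 0 else 1.

(** For even q a root would give a proper linear factor of an irreducible quadratic. This makes the
    norm form of F_q[Z] anisotropic. *)
Lemma admissible_no_root (Fq : finFieldType) (c r : Fq) :
  admissible_const c -> r ^+ 2 != trFq Fq * r + c.
Proof.
rewrite /admissible_const /trFq; case: ifP => qodd hc.
  by rewrite mul0r add0r.
apply/eqP; rewrite mul1r => rE; have [_ /(_ ('X - r%:P))] := hc.
have sp : size ('X^2 + 'X + c%:P) = 3.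
  by rewrite -addrA size_polyDl size_polyXn // size_XaddC.
have root_r : ('X^2 + 'X + c%:P).[r] = 0.
  (* In characteristic 2, [r^2 = r + c] gives [r^2 + r + c = 2(r + c) = 0]. *)
  rewrite !hornerE rE; transitivity ((1 + 1) * (r + c)); first by ring.
  by rewrite Fq_even ?qodd ?mul0r.
rewrite size_XsubC dvdp_XsubCl /root root_r eqxx => /(_ isT isT)/eqp_size.
by rewrite sp size_XsubC.
Qed.

(** A model of F_q[Z] outside [D c]. The admissibility proof is a parameter of the type, so that a
    field structure can be attached to it. *)
Record quadExt (Fq : finFieldType) (c : Fq) (hc : admissible_const c) :=
  QuadExt { l1 : Fq; lZ : Fq }.
Arguments QuadExt {Fq c hc}.

Section QuadExtField.
Variables (Fq : finFieldType) (c : Fq) (hc : admissible_const c).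
Local Notation L := (quadExt hc).
Local Notation s := (trFq Fq).

Definition quadExt_encode (x : L) := (l1 x, lZ x).
Definition quadExt_decode (x : Fq * Fq) : L := QuadExt x.1 x.2.
Lemma quadExt_encodeK : cancel quadExt_encode quadExt_decode.
Proof. by case. Qed.
HB.instance Definition _ := Finite.copy L (can_type quadExt_encodeK).

Lemma card_quadExt : #|{: L}| = (#|Fq| ^ 2)%N.
Proof.
have K : cancel quadExt_decode quadExt_encode by case.
by rewrite (bij_eq_card (Bijective quadExt_encodeK K)) card_prod mulnn.
Qed.

Definition quadExt_add (x y : L) : L := QuadExt (l1 x + l1 y) (lZ x + lZ y).
Definition quadExt_opp (x : L) : L := QuadExt (- l1 x) (- lZ x).
Definition quadExt_mul (x y : L) : L :=
  QuadExt (l1 x * l1 y + c * (lZ x * lZ y))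
          (l1 x * lZ y + lZ x * l1 y + s * (lZ x * lZ y)).
(** The product of [x] with its conjugate, as [Z] has trace [s] and norm [-c]. *)
Definition quadExt_norm (x : L) : Fq :=
  l1 x ^+ 2 + s * l1 x * lZ x - c * lZ x ^+ 2.
Definition quadExt_inv (x : L) : L :=
  QuadExt ((l1 x + s * lZ x) / quadExt_norm x) (- lZ x / quadExt_norm x).

Lemma quadExt_addA : associative quadExt_add.
Proof. by move=> [??] [??] [??]; congr QuadExt; exact: addrA. Qed.
Lemma quadExt_addC : commutative quadExt_add.
Proof. by move=> [??] [??]; congr QuadExt; exact: addrC. Qed.
Lemma quadExt_add0 : left_id (QuadExt 0 0) quadExt_add.
Proof. by move=> [??]; congr QuadExt; exact: add0r. Qed.
Lemma quadExt_addN : left_inverse (QuadExt 0 0) quadExt_opp quadExt_add.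
Proof. by move=> [??]; congr QuadExt; exact: addNr. Qed.

HB.instance Definition _ := GRing.isZmodule.Build L
  quadExt_addA quadExt_addC quadExt_add0 quadExt_addN.

Lemma quadExt_mulA : associative quadExt_mul.
Proof. by move=> [??] [??] [??]; congr QuadExt => /=; ring. Qed.
Lemma quadExt_mulC : commutative quadExt_mul.
Proof. by move=> [??] [??]; congr QuadExt => /=; ring. Qed.
Lemma quadExt_mul1 : left_id (QuadExt 1 0) quadExt_mul.
Proof. by move=> [??]; congr QuadExt => /=; ring. Qed.
Lemma quadExt_mulDl : left_distributive quadExt_mul quadExt_add.
Proof. by move=> [??] [??] [??]; congr QuadExt => /=; ring. Qed.
Lemma quadExt_1neq0 : QuadExt 1 0 != 0 :> L.
Proof. by apply/eqP => -[/eqP]; rewrite oner_eq0. Qed.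

HB.instance Definition _ := GRing.Zmodule_isComNzRing.Build L
  quadExt_mulA quadExt_mulC quadExt_mul1 quadExt_mulDl quadExt_1neq0.

Lemma quadExt_norm_neq0 (x : L) : x != 0 -> quadExt_norm x != 0.
Proof.
case: x => a b; rewrite /quadExt_norm /=; have [->|b0] := eqVneq b 0.
  rewrite mulr0 addr0 expr0n mulr0 subr0 sqrf_eq0; apply: contraNneq => -> //.
(* If [a + bZ] had norm 0 with [b] nonzero, then [-a/b] would be a root of [X^2 - sX - c]. *)
move=> _; apply: contraNneq (admissible_no_root (- (a / b)) hc) => n0.
apply/eqP; apply: (mulIf (expf_neq0 2 b0)); apply/eqP; rewrite -subr_eq0.
by apply/eqP; rewrite -[RHS]n0; field.
Qed.

Lemma quadExt_mulV (x : L) : x != 0 -> quadExt_inv x * x = 1.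
Proof.
move/quadExt_norm_neq0; case: x => a b; rewrite /quadExt_inv /quadExt_norm /=.
by move=> n0; congr QuadExt => /=; field.
Qed.

Lemma quadExt_inv0 : quadExt_inv 0 = 0.
Proof. by congr QuadExt; rewrite /= ?oppr0 ?mulr0 ?addr0 mul0r. Qed.

HB.instance Definition _ :=
  GRing.ComNzRing_isField.Build L quadExt_mulV quadExt_inv0.

Definition quadExt_conj (x : L) : L := QuadExt (l1 x + s * lZ x) (- lZ x).

Definition quadExtC (a : Fq) : L := QuadExt a 0.

Lemma quadExtC_is_zmod_morphism : zmod_morphism quadExtC.
Proof. by move=> a b; congr QuadExt; rewrite /= subr0. Qed.
HB.instance Definition _ :=
  GRing.isZmodMorphism.Build Fq L quadExtC quadExtC_is_zmod_morphism.

Lemma quadExtC_is_monoid_morphism : monoid_morphism quadExtC.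
Proof. by split=> // a b; congr QuadExt => /=; ring. Qed.
HB.instance Definition _ :=
  GRing.isMonoidMorphism.Build Fq L quadExtC quadExtC_is_monoid_morphism.

Lemma quadExt_mul_conj (x : L) : x * quadExt_conj x = quadExtC (quadExt_norm x).
Proof.
by case: x => a b; congr QuadExt => /=; rewrite /quadExt_norm /=; ring.
Qed.

(** The additive group of L is a p-group of order q^2, so q is a power of p; raising to the power q
    is therefore additive. *)
Lemma quadExt_pnat_card : [pchar L].-nat #|Fq|.
Proof.
have [p p_pr pL] := finPcharP L.
rewrite (eq_pnat _ (pcharf_eq pL)).
have := abelem_pgroup (fin_ring_pchar_abelem pL).
by rewrite /pgroup cardsT card_quadExt pnatX orbF.
Qed.

Lemma quadExt_expD (x y : L) : (x + y) ^+ #|Fq| = x ^+ #|Fq| + y ^+ #|Fq|.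
Proof. exact: exprDn_pchar quadExt_pnat_card. Qed.

Lemma quadExtC_expq (a : Fq) : quadExtC a ^+ #|Fq| = quadExtC a.
Proof. by rewrite -rmorphXn expf_card. Qed.

Definition quadExtZ : L := QuadExt 0 1.

Lemma quadExtE (x : L) : x = quadExtC (l1 x) + quadExtC (lZ x) * quadExtZ.
Proof. by case: x => a b; congr QuadExt => /=; ring. Qed.

Lemma quadExt_frobenius_split (x : L) :
  x ^+ #|Fq| = quadExtC (l1 x) + quadExtC (lZ x) * quadExtZ ^+ #|Fq|.
Proof.
by rewrite {1}[x]quadExtE quadExt_expD exprMn !quadExtC_expq.
Qed.

(** It suffices to treat [Z], whose q-th power is again a root of its quadratic equation, hence [Z]
    or its conjugate; the first is excluded by counting. *)
Lemma quadExt_frobenius (x : L) : x ^+ #|Fq| = quadExt_conj x.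
Proof.
set q := #|Fq|; pose Z := quadExtZ.
have ZqE : (Z ^+ q - Z) * (Z ^+ q - quadExt_conj Z) = 0.
  have ZE : Z ^+ 2 = quadExtC s * Z + quadExtC c.
    by congr QuadExt => /=; ring.
  have /= := congr1 (fun y => y ^+ q) ZE.
  rewrite exprAC quadExt_expD (exprMn _ (quadExtC s)) !quadExtC_expq => /eqP.
  rewrite -subr_eq0 => /eqP ZqE; rewrite -[RHS]ZqE.
  have -> : quadExtC s = Z + quadExt_conj Z.
    by congr QuadExt => /=; ring.
  have -> : quadExtC c = - (Z * quadExt_conj Z).
    by congr QuadExt => /=; ring.
  by ring.
have ZqN : Z ^+ q != Z.
  apply/eqP => Zq.
  (* If [Z] were fixed, all q^2 elements of L would be roots of [X^q - X]. *)
  have all_roots : all (root ('X^q - 'X)) (enum {: L}).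
    apply/allP => y _; rewrite /root !hornerE quadExt_frobenius_split Zq.
    by rewrite -quadExtE subrr.
  have sp : size ('X^q - 'X : {poly L}) = q.+1.
    by rewrite size_polyDl size_polyXn // size_polyN size_polyX ltnS
      finNzRing_gt1.
  have := max_poly_roots _ all_roots (enum_uniq _).
  rewrite -size_poly_eq0 sp -cardE card_quadExt => /(_ isT).
  have := (card_finField_gt1 Fq); rewrite -/q; nia.
move/eqP: ZqE; rewrite mulf_eq0 !subr_eq0 (negPf ZqN) /= => /eqP Zq.
rewrite quadExt_frobenius_split Zq; case: x => a b.
by congr QuadExt => /=; ring.
Qed.

Lemma quadExt_frobeniusK (x : L) : x ^+ #|Fq| ^+ #|Fq| = x.
Proof. by rewrite -exprM mulnn -card_quadExt expf_card. Qed.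

Lemma quadExt_expS (x : L) : x ^+ #|Fq|.+1 = quadExtC (quadExt_norm x).
Proof. by rewrite exprS quadExt_frobenius quadExt_mul_conj. Qed.

(** The order [m] of [d] divides q^2 - 1, and the [m] powers of [d] exhaust the q^2 - 1 nonzero
    elements. *)
Lemma quadExt_primitive (d : L) : d != 0 ->
    (forall x, x != 0 -> exists n, x = d ^+ n) ->
  (#|Fq| ^ 2 - 1).-primitive_root d.
Proof.
move=> d0 gen_d; set N := (#|Fq| ^ 2 - 1)%N.
have N0 : (0 < N)%N by have := (card_finField_gt1 Fq); rewrite /N; nia.
have dN : d ^+ N = 1.
  apply: (mulfI d0); rewrite -exprS mulr1 -[RHS]expf_card card_quadExt.
  by congr (_ ^+ _); rewrite /N in N0 *; lia.
have [m prim_d m_dvd] := prim_order_exists N0 dN.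
suff -> : N = m by [].
apply/eqP; rewrite eqn_leq (dvdn_leq _ m_dvd) // andbT.
have sub : [set~ 0 : L] \subset [set d ^+ (i : 'I_m) | i : 'I_m].
  apply/subsetP => x; rewrite !inE => /gen_d[n ->].
  apply/imsetP; exists (Ordinal (ltn_pmod n (prim_order_gt0 prim_d))) => //=.
  by rewrite prim_expr_mod.
have := leq_trans (subset_leq_card sub) (leq_imset_card _ _).
by rewrite cardsC1 card_ord card_quadExt /N subn1.
Qed.

End QuadExtField.

(** * Quaternions over a base ring and their reduction at a place *)

Section QuatMap.
Variables (R R' : comNzRingType) (psi : {rmorphism R -> R'}).
Variables (s c t : R) (s' c' t' : R').
Hypotheses (hs : psi s = s') (hc : psi c = c') (ht : psi t = t').

Definition quat_map (x : quat s c t) : quat s' c' t' :=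
  Quat (psi (q1 x)) (psi (qZ x)) (psi (qF x)) (psi (qFZ x)).

Lemma quat_map1 : quat_map 1 = 1.
Proof. by congr Quat => /=; rewrite ?rmorph1 ?rmorph0. Qed.

Lemma quat_mapM : {morph quat_map : x y / x * y}.
Proof.
move=> [????] [????].
by congr Quat; rewrite /= ?(rmorphD, rmorphN, rmorphM) ?hs ?hc ?ht.
Qed.
End QuatMap.

Lemma quat_scale_eq0 (R : idomainType) (s c t : R) (a : R) (x : quat s c t) :
  (a *: x == 0) = (a == 0) || (x == 0).
Proof.
have [-> | a0] := eqVneq a 0; first by rewrite scale0r eqxx.
apply/eqP/eqP => [|->]; last by rewrite scaler0.
have mul_eq0 (b : R) : a * b = 0 -> b = 0.
  by move/eqP; rewrite mulf_eq0 (negPf a0) => /eqP.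
by case: x => ???? [/mul_eq0-> /mul_eq0-> /mul_eq0-> /mul_eq0->].
Qed.

Section ExtInQuat.
Variables (Fq : finFieldType) (c : Fq) (hc : admissible_const c).
Local Notation L := (quadExt hc).
Local Notation q := #|Fq|.
Variables (R : comNzRingType) (phi : {rmorphism Fq -> R}) (s' c' t : R).
Hypotheses (phis : phi (trFq Fq) = s') (phic : phi c = c').
Local Notation Q := (quat s' c' t).

(** The base map [phi] is left general so that the same letters can be formed over F_q[t], over K
    and, after reduction, over F_q. *)
Definition ext_quat (x : L) : Q := Quat (phi (l1 x)) (phi (lZ x)) 0 0.

Lemma ext_quat1 : ext_quat 1 = 1.
Proof. by congr Quat; rewrite /= ?rmorph1 ?rmorph0. Qed.

Lemma ext_quatB : {morph ext_quat : x y / x - y}.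
Proof. by move=> x y; congr Quat => /=; rewrite ?rmorphB ?subrr. Qed.

Lemma ext_quatM : {morph ext_quat : x y / x * y}.
Proof.
move=> [a b] [a' b'].
by congr Quat; rewrite /= -?phis -?phic ?(rmorphD, rmorphN, rmorphM); ring.
Qed.

Lemma ext_quatC (a : Fq) : ext_quat (quadExtC hc a) = (phi a)%:A.
Proof. by congr Quat; rewrite /= ?mulr1 ?mulr0 ?rmorph0. Qed.

Lemma quatF_ext (x : L) : quatF * ext_quat x = ext_quat (x ^+ q) * quatF.
Proof.
rewrite quadExt_frobenius; case: x => a b.
by congr Quat; rewrite /= -?phis -?phic ?(rmorphD, rmorphN, rmorphM); ring.
Qed.

Definition gen_quat (x : L) : Q := 1 + ext_quat x * quatF.
End ExtInQuat.

(** * Reduction of the letters at a rational place *)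

Section LocalQuat.
Variables (Fq : finFieldType) (c : Fq) (hc : admissible_const c) (tau : Fq).
Local Notation L := (quadExt hc).
Local Notation q := #|Fq|.
Local Notation Q := (quat (trFq Fq) c tau).
Local Notation tauL := (quadExtC hc tau).

Definition pair_quat (u v : L) : Q :=
  ext_quat idfun _ _ _ u + ext_quat idfun _ _ _ v * quatF.

(** The basis contains [FZ], whereas here [v] stands to the left of [F]; since [vF = F conj(v)], the
    last two coordinates are those of [conj(v)]. *)
Lemma pair_quatE (u v : L) :
  pair_quat u v = Quat (l1 u) (lZ u) (l1 v + trFq Fq * lZ v) (- lZ v).
Proof. by congr Quat => /=; ring. Qed.

Lemma pair_quatM (u v u' v' : L) :
  pair_quat u v * pair_quat u' v' =
  pair_quat (u * u' + tauL * v * v' ^+ q) (u * v' + v * u' ^+ q).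
Proof.
rewrite !quadExt_frobenius !pair_quatE.
by case: u v u' v' => [??] [??] [??] [??]; congr Quat => /=; ring.
Qed.

Lemma pair_quat_inj (u v u' v' : L) :
  pair_quat u v = pair_quat u' v' -> u = u' /\ v = v'.
Proof.
rewrite !pair_quatE; case: u v u' v' => [a b] [a' b'] [a1 b1] [a1' b1'] [-> ->].
by move=> + /oppr_inj bE; rewrite /= bE => /addIr ->.
Qed.

Lemma pair_quat0 : pair_quat 0 0 = 0.
Proof. by rewrite pair_quatE; congr Quat => /=; ring. Qed.

Definition gen_local (x : L) : Q := gen_quat idfun _ _ _ x.

Lemma gen_localE x : gen_local x = pair_quat 1 x.
Proof. by rewrite /pair_quat ext_quat1. Qed.

(* For N(x) tau = 1 the left multiples by 1 + x F of elements of the local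
   algebra are the elements w + x w^q F, and multiplying such an element on the
   left by 1 + y F replaces w by w (x + y) / x. *)
Lemma gen_local_reduced x xs :
    all (fun y => tauL * y ^+ q.+1 == 1) (x :: xs) ->
    sorted (fun y z => y + z != 0) (x :: xs) ->
  exists2 w : L, w != 0 &
    \prod_(y <- x :: xs) gen_local y = pair_quat w (x * w ^+ q).
Proof.
elim: xs x => [|y xs IHxs] x.
  move=> _ _; exists 1; first exact: oner_neq0.
  by rewrite big_seq1 gen_localE expr1n mulr1.
move=> /andP[/eqP Nx allN] /andP[xy0 red]; rewrite big_cons.
have [w w0 ->] := IHxs y allN red; have /andP[/eqP Ny _] := allN.
have y0 : y != 0.
  apply/eqP => y0; move/eqP: Ny; rewrite y0 expr0n mulr0 eq_sym.
  by rewrite oner_eq0.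
have yq : tauL * y ^+ q = y^-1.
  by apply: (mulIf y0); rewrite mulVf // -mulrA -exprSr.
exists (w * (x + y) / y); first by rewrite !mulf_neq0 ?invr_eq0.
rewrite gen_localE pair_quatM; congr pair_quat.
  rewrite exprMn quadExt_frobeniusK.
  transitivity (w + w * x * (tauL * y ^+ q)); first by ring.
  by rewrite yq; field.
have xq : x * x ^+ q = y * y ^+ q.
  apply: (mulfI (x := tauL)); last by rewrite -!exprS Nx Ny.
  apply/eqP => t0; move/eqP: Nx; rewrite t0 mul0r eq_sym oner_eq0 //.
have yq0 : y ^+ q != 0 by rewrite expf_neq0.
rewrite !exprMn quadExt_expD exprVn.
transitivity (w ^+ q * (x * x ^+ q + x * y ^+ q) / y ^+ q); last by field.
by rewrite xq; field.
Qed.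

(** [(1 + xF)(1 - xF) = 1 - tau N(x)] is a nonzero scalar, so the inverse is [1 - xF] divided by
    it. *)
Lemma gen_local_unit x : tauL * x ^+ q.+1 != 1 ->
  exists y : Q, gen_local x * y = 1.
Proof.
rewrite quadExt_expS -rmorphM => Nx; set m := tau * _ in Nx.
have m1 : 1 - m != 0.
  by rewrite subr_eq0 eq_sym; apply: contraNneq Nx => ->; rewrite rmorph1.
have xq : tauL * x * x ^+ q = quadExtC hc m.
  by rewrite -mulrA -exprS quadExt_expS -rmorphM.
exists (pair_quat (quadExtC hc (1 - m)^-1) (x * quadExtC hc (- (1 - m)^-1))).
rewrite gen_localE pair_quatM exprMn !quadExtC_expq (mulrA (tauL * x)) xq.
rewrite !mul1r.
rewrite -rmorphM -mulrDr -!rmorphD addNr rmorph0 mulr0.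
have -> : (1 - m)^-1 + m * - (1 - m)^-1 = 1 by field.
by rewrite rmorph1 pair_quatE -[RHS]/(Quat 1 0 0 0); congr Quat => /=; ring.
Qed.

(** The annihilator is [1 - xF]: the element [w + x w^q F] equals [(1 + xF) w], and
    [(1 - xF)(1 + xF) = 1 - tau N(x) = 0]. *)
Lemma gen_local_annihilated x : tauL * x ^+ q.+1 = 1 ->
  exists2 y : Q, y != 0 & forall w, y * pair_quat w (x * w ^+ q) = 0.
Proof.
move=> Nx; exists (pair_quat 1 (- x)) => [|w].
  apply: contraTneq (oner_neq0 L) => /eqP; rewrite -pair_quat0 => /eqP.
  by case/pair_quat_inj => ->; rewrite eqxx.
rewrite pair_quatM exprMn quadExt_frobeniusK -pair_quat0; congr pair_quat.
  transitivity (w * (1 - tauL * (x * x ^+ q))); first by ring.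
  by rewrite -exprS Nx subrr mulr0.
by ring.
Qed.

Lemma gen_local_nonscalar x xs ys (b : Fq) :
    all (fun y => tauL * y ^+ q.+1 == 1) (x :: xs) ->
    sorted (fun y z => y + z != 0) (x :: xs) ->
    all (fun y => tauL * y ^+ q.+1 != 1) ys ->
  \prod_(y <- (x :: xs) ++ ys) gen_local y <> b%:A.
Proof.
move=> allN red allU; rewrite big_cat /=.
have [w w0 ->] := gen_local_reduced allN red.
have [|y y0 yP0] := @gen_local_annihilated x; first by case/andP: allN => /eqP.
(* Left multiplication by the annihilator [y] kills the product, so [b] times the nonzero [y]
   vanishes. *)
move=> prodE; have b0 : b = 0.
  move/(congr1 ( *%R y)): prodE; rewrite mulrA yP0 mul0r => /esym.
  rewrite -scalerAr mulr1 => /eqP; rewrite quat_scale_eq0 (negPf y0) orbF.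
  by move/eqP.
(* The remaining letters are invertible; cancelling them leaves the nonzero product of the letters
   in [x :: xs] equal to 0. *)
have [z unit_z] : exists z : Q, \prod_(y <- ys) gen_local y * z = 1.
  elim: ys allU {prodE} => [|y1 ys IHys] => [_|/andP[U1 /IHys[z zE]]].
    by exists 1; rewrite big_nil mulr1.
  have [z1 z1E] := gen_local_unit U1; exists (z * z1).
  by rewrite big_cons !mulrA -(mulrA (gen_local y1)) zE mulr1.
move/(congr1 ( *%R^~ z)): prodE; rewrite -mulrA unit_z mulr1 b0 scale0r mul0r.
by rewrite -pair_quat0 => /pair_quat_inj[w0' _]; rewrite w0' eqxx in w0.
Qed.
End LocalQuat.

(** * The division algebra over K *)

Lemma quat_map_gen (Fq : finFieldType) (c : Fq) (hc : admissible_const c)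
    (R R' : comNzRingType) (phi : {rmorphism Fq -> R})
    (phi' : {rmorphism Fq -> R'}) (psi : {rmorphism R -> R'})
    (s1 c1 t1 : R) (s2 c2 t2 : R') (x : quadExt hc) :
    (forall a, psi (phi a) = phi' a) -> psi s1 = s2 ->
  quat_map psi _ _ _ (gen_quat phi s1 c1 t1 x) = gen_quat phi' s2 c2 t2 x.
Proof.
move=> phiE <-; congr Quat; rewrite /= ?(rmorphD, rmorphN, rmorphM) ?phiE;
  rewrite ?rmorph0 ?rmorph1; ring.
Qed.

Section OverK.
Variables (Fq : finFieldType) (c : Fq) (hc : admissible_const c).
Local Notation L := (quadExt hc).
Local Notation q := #|Fq|.
Local Notation K := {fraction {poly Fq}}.

Lemma FqK_is_zmod_morphism : zmod_morphism (@FqK Fq).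
Proof. by move=> a b; rewrite /FqK polyCB tofracB. Qed.
HB.instance Definition _ :=
  GRing.isZmodMorphism.Build Fq K (@FqK Fq) FqK_is_zmod_morphism.

Lemma FqK_is_monoid_morphism : monoid_morphism (@FqK Fq).
Proof. by split=> [|a b]; rewrite /FqK ?polyC1 ?tofrac1 // polyCM tofracM. Qed.
HB.instance Definition _ :=
  GRing.isMonoidMorphism.Build Fq K (@FqK Fq) FqK_is_monoid_morphism.

Lemma FqK_tr : FqK (trFq Fq) = trZ Fq.
Proof. by rewrite /trFq /trZ; case: ifP => _; rewrite ?rmorph0 ?rmorph1. Qed.

Definition extD (x : L) : D c := ext_quat (@FqK Fq) _ _ _ x.

Lemma extD_is_zmod_morphism : zmod_morphism extD.
Proof. exact: ext_quatB. Qed.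
HB.instance Definition _ := GRing.isZmodMorphism.Build L (D c) extD
  extD_is_zmod_morphism.
Lemma extD_is_monoid_morphism : monoid_morphism extD.
Proof. by split; [apply: ext_quat1 | exact: (ext_quatM _ FqK_tr)]. Qed.
HB.instance Definition _ := GRing.isMonoidMorphism.Build L (D c) extD
  extD_is_monoid_morphism.

Lemma extD_C (a : Fq) : extD (quadExtC hc a) = (FqK a)%:A.
Proof. exact: ext_quatC. Qed.

Lemma DF_extD (x : L) : DF c * extD x = extD (x ^+ q) * DF c.
Proof. exact: (quatF_ext _ FqK_tr). Qed.

Lemma FqK_inj : injective (@FqK Fq).
Proof. exact: fmorph_inj. Qed.

Lemma extD_inj : injective extD.
Proof.
move=> [a b] [a' b'] eq_ab.
by congr QuadExt; apply: FqK_inj;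
  [apply: (congr1 (@q1 _ _ _ _) eq_ab) | apply: (congr1 (@qZ _ _ _ _) eq_ab)].
Qed.

Lemma inFqZP (x : D c) : inFqZ x <-> exists y : L, x = extD y.
Proof.
have E (a b : Fq) : (FqK a)%:A + FqK b *: DZ c = extD (QuadExt a b).
  by congr Quat => /=; rewrite ?mulr0 ?mulr1 ?addr0 ?add0r.
split=> [[a [b ->]]|[[a b] ->]]; first by exists (QuadExt a b).
by exists a, b; rewrite E.
Qed.

Definition linF (x : L) : D c := 1 + extD x * DF c.

(** A product of two letters thus depends only on [x + y] and [x y^q], the two quantities that the
    square relations preserve. *)
Lemma linFM (x y : L) :
  linF x * linF y = 1 + extD (x + y) * DF c + ('X%:F) *: extD (x * y ^+ q).
Proof.
rewrite /linF mulrDl mul1r mulrDr mulr1 -!addrA; congr (_ + _).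
rewrite addrCA addrA -mulrDl -rmorphD -mulrA (mulrA (DF c)) DF_extD -mulrA.
by rewrite -expr2 D_FF -scalerAr mulr1 -scalerAr -rmorphM.
Qed.

(** The scalar is the reduced norm of [1 + xF], and [1 - xF] is its conjugate. *)
Lemma linF_mulN (x : L) :
  linF x * linF (- x) = (1 - 'X%:F * FqK (quadExt_norm x))%:A.
Proof.
rewrite linFM subrr rmorph0 mul0r addr0 scalerBl scale1r.
have -> : x * (- x) ^+ q = - quadExtC hc (quadExt_norm x).
  rewrite -quadExt_expS exprS -mulrN !quadExt_frobenius; congr (_ * _).
  by case: x => a b; congr QuadExt => /=; ring.
by rewrite rmorphN /= extD_C scalerN scalerA.
Qed.

(** Letters have coefficients in F_q[t]. Their product [P] is formed there, then compared with its
    images in K and at [t = tau]. *)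
Lemma linF_prod_scalar (xs : seq L) (a : K) (tau : Fq) :
    \prod_(x <- xs) linF x = a%:A ->
  exists b : Fq, \prod_(x <- xs) gen_local tau x = b%:A.
Proof.
pose A : nzRingType := quat ((trFq Fq)%:P) (c%:P) ('X : {poly Fq}).
pose P : A := \prod_(x <- xs) gen_quat polyC _ _ _ x.
have PD : quat_map (@tofrac _) _ _ _ P = \prod_(x <- xs) linF x :> D c.
  rewrite (big_morph _ (quat_mapM _ _ _) (quat_map1 _ _ _ _ _ _ _)) //.
    apply: eq_bigr => x _; apply: quat_map_gen => //; exact: FqK_tr.
  exact: FqK_tr.
have Ptau :
    quat_map (horner_eval tau) _ _ _ P = \prod_(x <- xs) gen_local tau x.
  rewrite (big_morph _ (quat_mapM _ _ _) (quat_map1 _ _ _ _ _ _ _)) //=;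
    rewrite /horner_eval ?hornerC ?hornerX //.
  apply: eq_bigr => x _; apply: quat_map_gen => [b|] /=;
    by rewrite /horner_eval hornerC.
rewrite -PD -Ptau => Pscalar.
(* F_q[t] embeds in K, so being scalar can be read off over F_q[t] and survives evaluation. *)
have P0 : [/\ qZ P = 0, qF P = 0 & qFZ P = 0].
  split; apply/eqP; rewrite -tofrac_eq0; apply/eqP.
  - by move/(congr1 (@qZ _ _ _ _)): Pscalar => /= ->; rewrite mulr0.
  - by move/(congr1 (@qF _ _ _ _)): Pscalar => /= ->; rewrite mulr0.
  - by move/(congr1 (@qFZ _ _ _ _)): Pscalar => /= ->; rewrite mulr0.
case: P0 => PZ PF PFZ; exists (q1 P).[tau]; rewrite /quat_map PZ PF PFZ.
by congr Quat; rewrite /= /horner_eval ?horner0 ?mulr1 ?mulr0.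
Qed.
End OverK.

(** * Exponents of the generator *)

Lemma quadExt_expSN (Fq : finFieldType) (c : Fq) (hc : admissible_const c)
  (x : quadExt hc) : (- x) ^+ #|Fq|.+1 = x ^+ #|Fq|.+1.
Proof.
rewrite !quadExt_expS; congr (quadExtC _ _).
by case: x => a b; rewrite /quadExt_norm /=; ring.
Qed.

(** With [x = d^i] and [y = d^j], [z] is [d] to the power [x_exp i j], [u] is the letter of [l_exp]
    and [v] that of [k_exp]. Since [w^(q-1) = w^q / w], one gets [u = (x + y) x^q / (x + y)^q] and
    [v = (x + y) y^q / (x + y)^q]. *)
Lemma quadExt_exchange (Fq : finFieldType) (c : Fq) (hc : admissible_const c)
    (x y u v z : quadExt hc) :
    x != 0 -> y != 0 -> x + y != 0 ->
    z = 1 + y / x -> u = x / z ^+ #|Fq|.-1 ->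
    v = y / (z * x / y) ^+ #|Fq|.-1 ->
  v + u = x + y /\ v * u ^+ #|Fq| = x * y ^+ #|Fq|.
Proof.
move=> x0 y0 xy0; set q := #|Fq|.
have expP (w : quadExt hc) : w != 0 -> w ^+ q.-1 = w ^+ q / w.
  move=> w0; apply: (mulIf w0); rewrite divfK // -exprSr prednK //.
  exact: ltnW (card_finField_gt1 Fq).
have zE : 1 + y / x = (x + y) / x by field.
rewrite zE => -> {z zE}.
have -> : (x + y) / x * x / y = (x + y) / y by field; rewrite x0 y0.
rewrite !expP ?mulf_neq0 ?invr_eq0 // => -> ->.
rewrite !(exprMn, exprVn) !quadExt_frobeniusK !quadExt_expD.
have xq0 : x ^+ q != 0 by rewrite expf_neq0.
have yq0 : y ^+ q != 0 by rewrite expf_neq0.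
have xyq0 : x ^+ q + y ^+ q != 0 by rewrite -quadExt_expD expf_neq0.
by split; field; rewrite ?x0 ?y0 ?xq0 ?yq0 ?xyq0 ?xy0.
Qed.

Section Exponents.
Variables (Fq : finFieldType) (c : Fq) (hc : admissible_const c).
Local Notation L := (quadExt hc).
Local Notation q := #|Fq|.
Local Notation N := (q ^ 2 - 1)%N.
Local Notation ZN := 'Z_N.
Variable d : L.
Hypothesis prim_d : N.-primitive_root d.

Lemma modulus_gt1 : (1 < N)%N.
Proof. by have := card_finField_gt1 Fq; rewrite -mulnn; nia. Qed.

Lemma modulusE : N = (q.-1 * q.+1)%N.
Proof. by have := card_finField_gt1 Fq; rewrite -mulnn; nia. Qed.

Lemma prim_root_neq0 : d != 0.
Proof.
apply/eqP => d0; have := prim_expr_order prim_d; rewrite d0 expr0n.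
rewrite gtn_eqF; last exact: ltnW modulus_gt1.
by move/esym/eqP; rewrite oner_eq0.
Qed.

(** An element of Z/N acts as an exponent through its representative below N, which is harmless
    because [d] has order N. *)
Lemma exp_Zp_val n : d ^+ (n%:R : ZN) = d ^+ n.
Proof. by rewrite val_Zp_nat ?modulus_gt1 // prim_expr_mod. Qed.

Lemma exp_ZpD (i j : ZN) : d ^+ (i + j)%R = d ^+ i * d ^+ j.
Proof. by rewrite -exprD -[RHS]exp_Zp_val natrD !natr_Zp. Qed.

Lemma exp_Zp_neq0 (i : ZN) : d ^+ i != 0.
Proof. by rewrite expf_neq0 ?prim_root_neq0. Qed.

Lemma exp_ZpN (i : ZN) : d ^+ (- i)%R = (d ^+ i)^-1.
Proof.
by apply: (mulfI (exp_Zp_neq0 i)); rewrite -exp_ZpD subrr divff ?exp_Zp_neq0.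
Qed.

Lemma exp_ZpB (i j : ZN) : d ^+ (i - j)%R = d ^+ i / d ^+ j.
Proof. by rewrite exp_ZpD exp_ZpN. Qed.

Lemma exp_ZpMn (i : ZN) n : d ^+ (i *+ n)%R = d ^+ i ^+ n.
Proof. by rewrite -exprM -[RHS]exp_Zp_val natrM natr_Zp mulr_natr. Qed.

Lemma exp_Zp_inj : injective (fun i : ZN => d ^+ i).
Proof.
move=> i j /eqP; rewrite (eq_prim_root_expr prim_d) => /eqP ij.
have ltN (k : ZN) : (k < N)%N by rewrite -{2}(Zp_cast modulus_gt1).
by move: ij; rewrite !modn_small ?ltN // => /val_inj.
Qed.

Lemma exp_Zp_onto (x : L) : x != 0 -> exists i : ZN, x = d ^+ i.
Proof.
move=> x0; have xN : x ^+ N = 1.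
  apply: (mulfI x0); rewrite -exprS mulr1 -[RHS]expf_card card_quadExt.
  by congr (_ ^+ _); have := modulus_gt1; lia.
have [i ->] := prim_rootP prim_d xN.
by exists (i%:R); rewrite exp_Zp_val.
Qed.

(** As N = (q - 1)(q + 1), the element [d^(q+1)] has order q - 1. *)
Lemma norm_modn (i j : nat) :
  (d ^+ i ^+ q.+1 == d ^+ j ^+ q.+1) = (i == j %[mod q.-1]).
Proof.
rewrite -!exprM (eq_prim_root_expr prim_d) modulusE.
by rewrite -!muln_modl eqn_pmul2r.
Qed.

Lemma norm_coset (i m : ZN) : d ^+ (i + m *+ q.-1)%R ^+ q.+1 = d ^+ i ^+ q.+1.
Proof.
rewrite exp_ZpD exp_ZpMn exprMn -(exprM _ q.-1) -modulusE (exprAC _ m).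
by rewrite (prim_expr_order prim_d) expr1n mulr1.
Qed.

Lemma norm_eq_coset (i j : ZN) : d ^+ i ^+ q.+1 = d ^+ j ^+ q.+1 ->
  exists m : ZN, j = i + m *+ q.-1.
Proof.
move=> ij; have /dvdnP[n nE] : (q.-1 %| (j - i)%R)%N.
  have q1 : (0 < q.+1)%N by [].
  rewrite -(dvdn_pmul2r q1) -modulusE (prim_order_dvd prim_d) exprM exp_ZpB.
  by rewrite expr_div_n ij divff // expf_neq0 ?exp_Zp_neq0.
exists (n%:R); rewrite -mulrnA -nE natr_Zp addrC subrK //.
Qed.

(** This keeps in M the indices produced by the exchange and by negation, since both preserve
    norms. *)
Lemma union_of_cosets_norm (M : {set ZN}) (i j : ZN) :
  union_of_cosets M -> i \in M -> d ^+ i ^+ q.+1 = d ^+ j ^+ q.+1 -> j \in M.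
Proof.
move=> [P cosetP ->] /bigcupP[C CP iC] /norm_eq_coset[m ->].
apply/bigcupP; exists C => //; have [k CE] := cosetP C CP.
move: iC; rewrite {}CE => /imsetP[n _ ->]; apply/imsetP; exists (n + m) => //.
by rewrite mulrnDl addrA.
Qed.

Lemma exp_half : odd q -> d ^+ ((N./2)%:R : ZN) = -1.
Proof.
move=> qodd; rewrite exp_Zp_val.
have NE : (N./2 * 2 = N)%N by rewrite modulusE; have := odd_double_half q; nia.
(* The power squares to 1, and it is not 1 because 0 < N/2 < N. *)
apply/eqP; have : (d ^+ N./2) ^+ 2 == 1 by rewrite -exprM NE prim_expr_order.
rewrite sqrf_eq1 => /orP[|//]; rewrite -(prim_order_dvd prim_d).
by move/dvdn_leq; have := modulus_gt1; lia.
Qed.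
End Exponents.

(** * Group presentations *)

Section PresentationLift.
Local Open Scope quotient_scope.
Local Open Scope group_scope.
Variables (I : choiceType) (rel : word I -> word I -> Prop).
Local Notation P := (pres_group rel).
Local Notation gen := (pres_gen rel).

Lemma pres_gen_rel (u v : word I) : rel u v ->
  (\pi_P u) = (\pi_P v).
Proof. by move=> uv; apply/pres_piP/pres_rel. Qed.

Lemma pres_gen2 (i j : I) :
  gen i * gen j = (\pi_P [:: (true, i); (true, j)]).
Proof. exact: pres_piM. Qed.

(** Each inverse letter can be replaced by the generator that inverts it. *)
Lemma pres_pos_word :
    (forall i, exists j, gen j * gen i = 1) ->
  forall x : P, exists s, x = \prod_(i <- s) gen i.
Proof.
move=> inv_gen; elim/quotW; elim=> [|[b i] u [s sE]].
  by exists [::]; rewrite big_nil.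
have -> : (\pi_P ((b, i) :: u)) = (\pi_P [:: (b, i)]) * (\pi_P u) :> P.
  by symmetry; apply: pres_piM.
rewrite sE; case: b; first by exists (i :: s); rewrite big_cons.
have [j ji] := inv_gen i; exists (j :: s); rewrite big_cons; congr (_ * _).
apply: (mulIg (gen i)); rewrite ji; apply: etrans (pres_piM _ _ _) _.
exact/pres_piP/(pres_cancel rel false).
Qed.

Variables (G : groupType) (phi : I -> G).
Definition word_eval (u : word I) : G :=
  \prod_(p <- u) (if p.1 then phi p.2 else (phi p.2)^-1).
Hypothesis phi_rel : forall u v, rel u v -> word_eval u = word_eval v.

Lemma word_eval_pres_eq u v : pres_eq rel u v -> word_eval u = word_eval v.
Proof.
elim=> // [u1 v1 w1 _ -> //|u1 v1 u2 v2 _ E1 _ E2|b i].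
  by rewrite /word_eval !big_cat -!/(word_eval _) E1 E2.
by rewrite /word_eval !big_cons big_nil mulg1; case: b;
  rewrite /= ?mulgV ?mulVg.
Qed.

(** The representative is arbitrary; [word_eval_pres_eq] makes the value independent of it. *)
Definition pres_lift (x : P) : G := word_eval (repr x).

Lemma pres_lift_pi u : pres_lift (\pi_P u) = word_eval u.
Proof. exact/word_eval_pres_eq/pres_repr. Qed.

Lemma pres_liftM : {morph pres_lift : x y / x * y}.
Proof.
elim/quotW=> u; elim/quotW=> v; rewrite [_ * _]pres_piM !pres_lift_pi.
by rewrite /word_eval big_cat.
Qed.

Lemma pres_lift_gen i : pres_lift (gen i) = phi i.
Proof. by rewrite pres_lift_pi /word_eval big_seq1. Qed.

Lemma pres_lift1 : pres_lift 1 = 1.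
Proof. by rewrite [pres_lift 1]pres_lift_pi /word_eval big_nil. Qed.

Lemma pres_universal :
  exists f : UMagmaMorphism.type P G, forall i, f (gen i) = phi i.
Proof.
pose fM := isUMagmaMorphism.Build P G pres_lift (conj pres_lift1 pres_liftM).
pose f : UMagmaMorphism.type P G := HB.pack pres_lift fM.
by exists f => i; apply: pres_lift_gen.
Qed.
End PresentationLift.

(** * Sorting a word by the types of its letters *)

Section Sorting.
Local Open Scope group_scope.
Variables (G : groupType) (I T : eqType) (g : I -> G) (ty : I -> T).
Hypothesis exchange : forall i j, ty i != ty j ->
  exists k l, [/\ ty k = ty j, ty l = ty i & g i * g j = g k * g l].

(** A letter passes through a block of another type; all letters may change, but types and the block
    length do not. *)
Lemma move_to_end i s t : ty i != t -> all (fun j => ty j == t) s ->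
  exists s' i', [/\ size s' = size s, all (fun j => ty j == t) s',
    ty i' = ty i &
    g i * \prod_(j <- s) g j = \prod_(j <- s') g j * g i'].
Proof.
elim: s i => [|j s IHs] i it.
  by exists [::], i; rewrite !big_nil mulg1 mul1g.
move=> /andP[/eqP jt all_s]; rewrite -jt in it.
have [k [l [kj li gE]]] := exchange it.
have [|s' [i' [szE all_s' i'l gsE]]] := IHs l _ all_s; first by rewrite li -jt.
exists (k :: s'), i'; rewrite /= szE all_s' kj jt eqxx i'l li; split=> //.
by rewrite !big_cons mulgA gE -mulgA gsE mulgA.
Qed.

Lemma sort_to_front s t : exists s1 s2,
  [/\ (size s1 + size s2)%N = size s, all (fun j => ty j == t) s1,
      all (fun j => ty j != t) s2 &
      \prod_(j <- s) g j = \prod_(j <- s1 ++ s2) g j].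
Proof.
elim: s => [|i s [s1 [s2 [szE all1 all2 gE]]]]; first by exists [::], [::].
have [it|it] := eqVneq (ty i) t.
  by exists (i :: s1), s2; rewrite /= it eqxx addSn szE !big_cons gE.
have [s1' [i' [sz1 all1' i'i g1E]]] := move_to_end it all1.
exists s1', (i' :: s2); rewrite /= sz1 addnS szE i'i it; split=> //.
by rewrite big_cons gE !big_cat big_cons mulgA /= g1E -mulgA.
Qed.

End Sorting.

Lemma not_sorted_split (T : Type) (r : rel T) (s : seq T) : ~~ sorted r s ->
  exists s1 x y s2, s = s1 ++ [:: x, y & s2] /\ ~~ r x y.
Proof.
elim: s => [//|x [//|y s] IHs] /=; rewrite negb_and => /orP[xy|/IHs].
  by exists [::], x, y, s.
by move=> [s1 [x1 [y1 [s2 [-> xy]]]]]; exists (x :: s1), x1, y1, s2.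
Qed.

(** * The isomorphism *)

Section Units.
Variables (Fq : finFieldType) (c : Fq) (hc : admissible_const c).
Local Notation L := (quadExt hc).
Variable S : placeSet Fq.

Lemma S_orderD (x y : D c) : S_order S x -> S_order S y -> S_order S (x + y).
Proof. by move=> [????] [????]; split; apply: S_integerD. Qed.

Lemma linF_order (x : L) : S_order S (linF x).
Proof.
have int0 := S_integer0 S; have int1 := S_integer1 S.
apply: S_orderD; first exact: S_order1.
by apply: S_orderM; split=> //=; apply: S_integer_tofrac.
Qed.

(** The only monic irreducible divisor of [X - a] is [X - a] itself, whose place belongs to S. *)
Lemma integer_inv_place (a : Fq) : Some a \in places S ->
  S_integer S (('X - a%:P)%:F)^-1.
Proof.
move=> aS; apply/S_integerP => pi pi_monic [pi_size pi_irr] /(_ a aS) pi_neq.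
exists 1, ('X - a%:P); split; first by rewrite tofrac1 div1r.
apply: contra pi_neq => pi_dvd; rewrite -eqp_monic ?monicXsubC //.
have [_ irrX] : irreducible_poly ('X - a%:P).
  exact: irredp_XsubC.
by apply: irrX => //; rewrite neq_ltn pi_size orbT.
Qed.

Lemma norm_factor (x : L) (tau : Fq) : tau * quadExt_norm x = 1 ->
  1 - 'X%:F * FqK (quadExt_norm x) =
  FqK (- quadExt_norm x) * ('X - tau%:P)%:F.
Proof.
move=> Nx; rewrite tofracB rmorphN /= mulNr mulrBr opprB.
have <- : FqK tau * FqK (quadExt_norm x) = 1.
  by rewrite -[LHS]rmorphM Nx rmorph1.
by rewrite -/(FqK tau); ring.
Qed.

Lemma norm_factor_unit (x : L) (tau : Fq) :
    Some tau \in places S -> tau * quadExt_norm x = 1 ->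
  S_integer_unit S (1 - 'X%:F * FqK (quadExt_norm x)).
Proof.
move=> tauS Nx; rewrite (norm_factor Nx); apply: S_integer_unitM.
  split; first exact: S_integer_tofrac.
  exists (FqK (- tau)); split; first exact: S_integer_tofrac.
  by rewrite -rmorphM mulrNN mulrC Nx rmorph1.
split; first exact: S_integer_tofrac.
exists (('X - tau%:P)%:F)^-1; split; first exact: integer_inv_place.
by rewrite mulfV // tofrac_eq0 polyXsubC_eq0.
Qed.

(** The inverse is [1 - xF] divided by the reduced norm, a constant times [t - tau], which is
    invertible away from S. *)
Lemma linF_unit (x : L) (tau : Fq) :
  Some tau \in places S -> tau * quadExt_norm x = 1 -> S_order_unit S (linF x).
Proof.
move=> tauS Nx; split; first exact: linF_order.
have [_ [b [bS ab]]] := norm_factor_unit tauS Nx.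
have NN : quadExt_norm (- x) = quadExt_norm x.
  by case: (x) => u v; rewrite /quadExt_norm /=; ring.
exists (b *: linF (- x)); split.
- by apply: S_orderZ => //; apply: linF_order.
- by rewrite -scalerAr linF_mulN scalerA mulrC ab scale1r.
rewrite -scalerAl -[X in _ * linF X]opprK linF_mulN NN scalerA mulrC ab.
exact: scale1r.
Qed.

Lemma Lambda_pi_prod (I : Type) (s : seq I) (U : I -> order_unit S c) :
  (\prod_(i <- s) Lambda_pi (U i))%g = Lambda_pi (\prod_(i <- s) U i)%g.
Proof.
symmetry; apply: (big_morph (@Lambda_pi Fq S c)) => // u v.
by symmetry; apply: Lambda_piM.
Qed.

Lemma order_unit_val_prod (I : Type) (s : seq I) (U : I -> order_unit S c) :
  val (\prod_(i <- s) U i)%g = \prod_(i <- s) val (U i).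
Proof. exact: (big_morph val). Qed.
End Units.

Lemma FqZ_generator_lift (Fq : finFieldType) (c : Fq) (hc : admissible_const c)
    (delta : D c) : FqZ_generator delta ->
  exists2 d : quadExt hc, delta = extD d & (#|Fq| ^ 2 - 1).-primitive_root d.
Proof.
move=> [/(inFqZP hc)[d ->] d0 gen_d]; exists d => //.
apply: quadExt_primitive => [|x x0].
  by apply: contraNneq d0 => ->; rewrite rmorph0.
have [||n] := gen_d (extD x).
- by apply/inFqZP; exists x.
- by apply: contraNneq x0 => x0; apply/eqP/extD_inj; rewrite x0 rmorph0.
by rewrite -rmorphXn => /extD_inj ->; exists n.
Qed.

Lemma quadExt_even_opp (Fq : finFieldType) (c : Fq) (hc : admissible_const c)
  (x : quadExt hc) : ~~ odd #|Fq| -> - x = x.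
Proof.
move=> qeven; apply/eqP; rewrite eq_sym -addr_eq0 -[x]mulr1 -mulrDr.
by rewrite -(rmorph1 (quadExtC hc)) -rmorphD Fq_even // rmorph0 mulr0.
Qed.

(** * Generators of the two groups and their relations *)

Section Gamma.
Variables (Fq : finFieldType) (c : Fq) (hc : admissible_const c).
Local Notation L := (quadExt hc).
Local Notation q := #|Fq|.
Local Notation K := {fraction {poly Fq}}.
Local Notation N := (q ^ 2 - 1)%N.
Local Notation ZN := 'Z_N.
Variables (d : L) (M : {set ZN}).
Hypotheses (prim_d : N.-primitive_root d) (hM : union_of_cosets M).
Local Notation delta := (extD d).
Local Notation S := (SM delta M).
Local Notation I := (GammaM_index M).

Definition gexp (i : I) : L := d ^+ val i.
(** The zero of the reduced norm [1 - t N(d^i)], that is, the place [d^(-i(q+1))]. *)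
Definition gtau (i : I) : Fq := (quadExt_norm (gexp i))^-1.

Lemma gexp_neq0 i : gexp i != 0.
Proof. exact: exp_Zp_neq0. Qed.

Lemma gtauM i : gtau i * quadExt_norm (gexp i) = 1.
Proof. by rewrite mulVf ?quadExt_norm_neq0 ?gexp_neq0. Qed.

Lemma gtau_place i : Some (gtau i) \in places S.
Proof.
rewrite /places /= inE; apply/orP; right; apply/imsetP; exists (gtau i) => //.
rewrite inE; apply/existsP; exists (val i); rewrite (valP i) /=.
rewrite -extD_C -rmorphXn exp_ZpN // exp_ZpMn // quadExt_expS.
by rewrite /gtau fmorphV.
Qed.

Lemma gtau_notin_B i : Some (gtau i) \notin P1B Fq.
Proof.
rewrite !inE orbF; apply/eqP => -[tau0].
by have := gtauM i; rewrite tau0 mul0r => /esym/eqP; rewrite oner_eq0.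
Qed.

Definition gunit (i : I) : order_unit S c :=
  exist _ (linF (gexp i)) (asboolT (linF_unit (gtau_place i) (gtauM i))).

Lemma gunit_PA i : PA (gtau i) (Lambda_pi (gunit i)).
Proof.
exists (extD (gexp i)); split; first by apply/inFqZP; exists (gexp i).
  by rewrite /FqZ_norm -rmorphXn /= quadExt_expS invrK extD_C.
by exists (gunit i).
Qed.

Lemma gunit_generated i :
  Defs.generated (fun g : Lambda S c =>
    exists2 tau : Fq, Some tau \in places S :\: P1B Fq & PA tau g)
    (Lambda_pi (gunit i)).
Proof.
apply/asboolP => H _; apply; exists (gtau i); last exact: gunit_PA.
by rewrite in_setD gtau_notin_B gtau_place.
Qed.

Definition ggen (i : I) : GammaS S c :=
  exist _ (Lambda_pi (gunit i)) (gunit_generated i).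

Lemma ggen_mul_eq (i j k l : I) :
  gexp i + gexp j = gexp k + gexp l ->
  gexp i * gexp j ^+ q = gexp k * gexp l ^+ q ->
  (ggen i * ggen j = ggen k * ggen l)%g.
Proof.
move=> addE mulE; apply: val_inj; rewrite !valM /=.
rewrite [LHS]Lambda_piM [RHS]Lambda_piM; congr Lambda_pi; apply: val_inj => /=.
by rewrite !linFM addE mulE.
Qed.

(** The product of the two representatives is their reduced norm, a scalar unit, hence trivial in
    Lambda. *)
Lemma ggen_inv (i j : I) : gexp j = - gexp i -> (ggen i * ggen j = 1)%g.
Proof.
move=> jE; apply: val_inj; rewrite valM val1 /= [LHS]Lambda_piM.
symmetry; apply/Lambda_piP; exists (1 - 'X%:F * FqK (quadExt_norm (gexp i))).
  exact: norm_factor_unit (gtau_place i) (gtauM i).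
by rewrite /= jE linF_mulN.
Qed.

(** The type of a letter, as an element of L; it records [i] modulo q - 1, and [gtau i] is its
    inverse in F_q. *)
Definition gty (i : I) : L := gexp i ^+ q.+1.

Lemma gty_modn (i j : I) : (gty i == gty j) = (val i == val j %[mod q.-1]).
Proof. exact: norm_modn. Qed.

Lemma gty_index (i : I) (k : ZN) : d ^+ k ^+ q.+1 = gty i ->
  exists j : I, val j = k.
Proof.
move=> kE; have kM := union_of_cosets_norm prim_d hM (valP i) (esym kE).
by exists (exist _ k kM).
Qed.

Lemma gexp_add_neq0 (i j : I) : gty i != gty j -> gexp i + gexp j != 0.
Proof.
apply: contraNneq => /eqP; rewrite addr_eq0 /gty => /eqP ->.
by rewrite quadExt_expSN.
Qed.

Lemma x_expE (i j : I) : gty i != gty j ->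
  d ^+ x_exp delta (val i) (val j) = 1 + gexp j / gexp i.
Proof.
move=> ij; have z0 : 1 + gexp j / gexp i != 0.
  have -> : 1 + gexp j / gexp i = (gexp i + gexp j) / gexp i.
    by field; apply: gexp_neq0.
  by rewrite mulf_neq0 ?invr_eq0 ?gexp_neq0 ?gexp_add_neq0.
rewrite /x_exp; case: pickP => [x /eqP|no_x].
  rewrite -!rmorphXn -(rmorph1 (@extD Fq c hc)) -rmorphD => /extD_inj ->.
  by rewrite exp_ZpB.
(* The default value of [x_exp] never occurs: the nonzero right-hand side is a power of [d]. *)
have [x xE] := exp_Zp_onto prim_d z0; have /eqP[] := no_x x.
by rewrite -!rmorphXn -(rmorph1 (@extD Fq c hc)) -rmorphD -xE exp_ZpB.
Qed.

Lemma gexp_exchange (i j k l : I) : gty i != gty j ->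
    val k = k_exp delta (val i) (val j) ->
    val l = l_exp delta (val i) (val j) ->
  gexp k + gexp l = gexp i + gexp j /\
  gexp k * gexp l ^+ q = gexp i * gexp j ^+ q.
Proof.
move=> ij kE lE; apply: quadExt_exchange (x_expE ij) _ _; rewrite ?gexp_neq0 //.
- exact: gexp_add_neq0.
- by rewrite /gexp lE /l_exp exp_ZpB // exp_ZpMn.
- by rewrite /gexp kE /k_exp exp_ZpB // exp_ZpMn // /y_exp exp_ZpB // exp_ZpD.
Qed.

(** [k_exp] and [l_exp] differ from [j] and [i] by multiples of q - 1, so they have the same norms
    and lie in M. *)
Lemma exchange_index (i j : I) : exists k l : I,
  [/\ gty k = gty j, gty l = gty i, val k = k_exp delta (val i) (val j) &
      val l = l_exp delta (val i) (val j)].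
Proof.
have kE : d ^+ k_exp delta (val i) (val j) ^+ q.+1 = gty j.
  by rewrite /k_exp -mulNrn norm_coset.
have lE : d ^+ l_exp delta (val i) (val j) ^+ q.+1 = gty i.
  by rewrite /l_exp -mulNrn norm_coset.
have [k kE'] := gty_index kE; have [l lE'] := gty_index lE.
by exists k, l; rewrite kE' lE' /gty /gexp kE' lE' kE lE.
Qed.

Local Notation Gamma := (GammaM delta M).
Local Notation gen := (GammaM_gen delta).

Lemma gen_exchange (i j : I) : gty i != gty j ->
  exists k l, [/\ gty k = gty j, gty l = gty i &
    (gen i * gen j = gen k * gen l)%g].
Proof.
move=> ij; have [k [l [kj li kE lE]]] := exchange_index i j; exists k, l.
split=> //; rewrite [LHS]pres_gen2 [RHS]pres_gen2; apply: pres_gen_rel.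
by apply: GammaM_rel_square => //; rewrite -gty_modn.
Qed.

Lemma gexp_odd (i h : I) : odd q -> val h = val i + ((N)./2)%:R ->
  gexp h = - gexp i.
Proof. by move=> qodd hE; rewrite /gexp hE exp_ZpD // exp_half // mulrN1. Qed.

(** For odd q the index is shifted by N/2, as [d^(N/2) = -1]; for even q, [-1 = 1] and the generator
    is its own inverse. *)
Lemma gen_inverse (i : I) :
  exists j, gexp j = - gexp i /\ (gen j * gen i = 1)%g.
Proof.
have [qodd|qeven] := boolP (odd q).
  have [|h hE] := @gty_index i (val i + (N./2)%:R).
    by rewrite exp_ZpD // exp_half // mulrN1 quadExt_expSN.
  exists h; split; first exact: gexp_odd.
  rewrite [LHS]pres_gen2;
  apply: (@pres_gen_rel _ (@GammaM_rel _ _ delta M) _ [::]).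
  exact: GammaM_rel_odd.
exists i; split; first by rewrite quadExt_even_opp.
rewrite [LHS]pres_gen2;
  apply: (@pres_gen_rel _ (@GammaM_rel _ _ delta M) _ [::]).
exact: GammaM_rel_even.
Qed.

Lemma gexp_inj : injective gexp.
Proof. by move=> i j /(exp_Zp_inj prim_d)/val_inj. Qed.

Lemma gen_mul_eq1 (i j : I) : gexp i + gexp j = 0 -> (gen i * gen j = 1)%g.
Proof.
move=> /eqP; rewrite addr_eq0 => /eqP iE.
have [k [kE gen1]] := gen_inverse j.
by rewrite (gexp_inj (etrans iE (esym kE))).
Qed.

Lemma ggen_rel u v :
  GammaM_rel delta u v -> word_eval ggen u = word_eval ggen v.
Proof.
rewrite /word_eval => -[i j k l|i h|i].
- rewrite -gty_modn => ij kE lE; rewrite !big_cons !big_nil /= !mulg1.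
  by have [addE mulE] := gexp_exchange ij kE lE; apply: ggen_mul_eq.
- move=> qodd hE; rewrite !big_cons !big_nil /= !mulg1; apply: ggen_inv.
  by rewrite (gexp_odd qodd hE) opprK.
move=> qeven; rewrite !big_cons !big_nil /= !mulg1; apply: ggen_inv.
by rewrite quadExt_even_opp.
Qed.
Lemma reduced_nonscalar (i : I) (s1 s2 : seq I) (a : K) :
    all (fun j => gty j == gty i) s1 -> all (fun j => gty j != gty i) s2 ->
    sorted (fun j k => gexp j + gexp k != 0) (i :: s1) ->
  \prod_(j <- (i :: s1) ++ s2) linF (gexp j) <> a%:A.
Proof.
move=> all1 all2 red prodE.
(* At the place of [i], letters of the type of [i] degenerate and all others stay invertible. *)
have tauE j : (quadExtC hc (gtau i) * gexp j ^+ q.+1 == 1) = (gty j == gty i).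
  rewrite -[RHS](inj_eq (mulfI (x := quadExtC hc (gtau i)) _)).
    by rewrite /gty [gexp i ^+ _]quadExt_expS -rmorphM gtauM rmorph1.
  apply/eqP => t0; move: (congr1 (quadExtC hc) (gtauM i)).
  by rewrite rmorphM /= t0 mul0r rmorph1 => /esym/eqP; rewrite oner_eq0.
have := prodE; rewrite -(big_map gexp predT (fun x => linF x)).
case/(linF_prod_scalar (gtau i)) => b; rewrite map_cat /=.
apply: gen_local_nonscalar.
- by rewrite /= tauE eqxx all_map; apply: sub_all all1 => j; rewrite /= tauE.
- by move: red; rewrite -map_cons sorted_map.
by rewrite all_map; apply: sub_all all2 => j; rewrite /= tauE.
Qed.

Lemma ggen_prod_scalar (s : seq I) : (\prod_(i <- s) ggen i = 1)%g ->
  exists a : K, \prod_(i <- s) linF (gexp i) = a%:A.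
Proof.
move/(congr1 val); rewrite val1 gmulf_prod => prodE.
have : Lambda_pi 1%g = Lambda_pi (\prod_(i <- s) gunit i)%g.
  by rewrite -Lambda_pi_prod; symmetry.
by case/Lambda_piP => a _; rewrite order_unit_val_prod => E; exists a.
Qed.

(** * Injectivity and surjectivity *)

Section Morphism.
Variable f : UMagmaMorphism.type Gamma (GammaS S c).
Hypothesis fE : forall i, f (gen i) = ggen i.

Lemma morphism_gen_prod (s : seq I) :
  f (\prod_(i <- s) gen i)%g = (\prod_(i <- s) ggen i)%g.
Proof. by rewrite gmulf_prod; apply: eq_bigr. Qed.

(** Induction on length: a nonempty word, once sorted, is either reduced at its first type, hence
    not in the kernel, or can be shortened. *)
Lemma morphism_gen_prod_eq1 (s : seq I) :
  f (\prod_(i <- s) gen i)%g = 1%g -> (\prod_(i <- s) gen i = 1)%g.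
Proof.
have [n] := ubnP (size s); elim: n s => // n IHn [|i s].
  by rewrite !big_nil.
rewrite ltnS => sn.
(* Only the tail is sorted, so [i] stays in front and the first block is nonempty. *)
have [s1 [s2 [szE all1 all2 genE]]] := sort_to_front gen_exchange s (gty i).
have -> : (\prod_(j <- i :: s) gen j = \prod_(j <- (i :: s1) ++ s2) gen j)%g.
  by rewrite !big_cons genE.
have [red|] := boolP (sorted (fun j k => gexp j + gexp k != 0) (i :: s1)).
  rewrite morphism_gen_prod => /ggen_prod_scalar[a].
  by move/(reduced_nonscalar all1 all2 red).
(* Two adjacent letters of the first block are opposite and cancel, leaving a word shorter by
   two. *)
case/not_sorted_split => t1 [j [k [t2 [isE /negPn/eqP jk0]]]].
have -> : (\prod_(h <- (i :: s1) ++ s2) gen h =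
           \prod_(h <- t1 ++ t2 ++ s2) gen h)%g.
  rewrite isE -catA !big_cat !big_cons /=.
  by rewrite !mulgA -(mulgA _ (gen j)) (gen_mul_eq1 jk0) mulg1.
apply: IHn; apply: leq_trans _ sn.
rewrite /= ltnS -szE !size_cat addnA leq_add2r.
by move/(congr1 size): isE; rewrite size_cat /= !addnS => -[->]; rewrite leqW.
Qed.

Lemma morphism_surj g : exists x, f x = g.
Proof.
case: g => g gP; have /asboolP gen_g := gP.
(* The image of [f] is a subgroup, so it suffices that it contains every [PA tau]. *)
pose H : {pred Lambda S c} := fun g => `[< exists x, val (f x) = g >].
suff /asboolP[x xg] : g \in H by exists x; apply: val_inj.
apply: gen_g.
- split=> [|_ _ /asboolP[x <-] /asboolP[y <-]]; apply/asboolP.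
    by exists 1%g; rewrite gmulf1 val1.
  by exists (x * y^-1)%g; rewrite gmulfM gmulfV valM gmulfV.
move=> y [tau]; rewrite in_setD => /andP[tauB tauS].
have [i iM tauE] : exists2 i, i \in M & tau^-1 = quadExt_norm (d ^+ i).
  move: tauS; rewrite in_setU (negPf tauB) /= => /imsetP[tau' + [->]].
  rewrite inE => /existsP[i /andP[iM]]; rewrite -extD_C -rmorphXn /=.
  rewrite exp_ZpN // exp_ZpMn // quadExt_expS -fmorphV => /eqP /extD_inj.
  by move/fmorph_inj => ->; exists i; rewrite ?invrK.
move=> [alpha [/(inFqZP hc)[x ->]]].
rewrite /FqZ_norm -rmorphXn /= -extD_C => /extD_inj xN [u uE ->].
have x0 : x != 0.
  apply: contraNneq (exp_Zp_neq0 prim_d i) => x0; move: xN.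
  rewrite x0 expr0n tauE -quadExt_expS => /esym/eqP.
  by rewrite expf_eq0.
(* The coefficient is some [d^j] with the norm of [d^i], so [j] lies in M with [i]. *)
have [j jE] := exp_Zp_onto prim_d x0.
have jM : j \in M.
  apply: (union_of_cosets_norm prim_d hM iM).
  by rewrite -jE xN quadExt_expS tauE.
apply/asboolP; exists (gen (exist _ j jM)); rewrite fE /=.
by congr Lambda_pi; apply: val_inj; rewrite /= uE jE.
Qed.

Lemma morphism_bij : bijective f.
Proof.
have f_inj : injective f.
  apply: gmulf_inj => x.
  have [|s ->] := @pres_pos_word _ (@GammaM_rel _ _ delta M) _ x.
    by move=> i; have [j [_ ji]] := gen_inverse i; exists j.
  exact: morphism_gen_prod_eq1.
have [g fK] := choice morphism_surj.
by exists g => // x; apply: f_inj; rewrite fK.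
Qed.

End Morphism.
End Gamma.

Theorem corollary2p33 (Fq : finFieldType) (c : Fq) (hc : admissible_const c)
    (delta : D c) (hdelta : FqZ_generator delta)
    (M : {set 'Z_(#|Fq| ^ 2 - 1)}) (hM : union_of_cosets M) :
  exists f : {multiplicative GammaM delta M -> GammaS (SM delta M) c},
    (forall i : GammaM_index M,
       is_class (1 + delta ^+ (val i) * DF c) (val (f (GammaM_gen delta i)))) /\
    bijective f.
Proof.
have [d -> prim_d] := FqZ_generator_lift hc hdelta.
have [f fE] := pres_universal (ggen_rel prim_d (M := M)).
exists f; split=> [i|]; last exact: (morphism_bij hM fE).
rewrite fE; exists (gunit prim_d i) => //=.
by rewrite /linF /gexp rmorphXn.
Qed.
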